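(* Let $p(\cdot)\in\mathcal{P}$ with $p_->1$ and $p(\cdot)\in LH$. Then, for any matrix weight $W$ with values in $M_m$, $W\in\mathscr{A}_{p(\cdot),\infty}$ if and only if $W\in\mathscr{A}_{1,\infty}$ and, for any matrix $M\in M_m$ and any cube $Q$ in $\mathbb{R}^n$, $$\frac{1}{\|\mathbf{1}_Q\|_{L^{p(\cdot)}}}\left\|\,\|W(\cdot)M\|\,\mathbf{1}_Q\right\|_{L^{p(\cdot)}}\le C\,[W]_{\mathscr{A}_{p(\cdot),\infty}}\fint_Q\|W(x)M\|\,dx,$$ where $C$ is a positive constant independent of $W$, $M$, and $Q$.
   Context: $m,n\in\mathbb{N}$; $M_m$ is the set of $m\times m$ complex matrices, with operator norm $\|A\|:=\sup_{\vec z\in\mathbb{C}^m,|\vec z|=1}|A\vec z|$. $\mathcal{P}$ is the set of measurable $p:\mathbb{R}^n\to[1,\infty]$; $p_-:=\operatorname{ess\,inf}_{x\in\mathbb{R}^n}p(x)$. A measurable real-valued function $r$ on $\mathbb{R}^n$ belongs to $LH$ if there is a positive constant $C_0$ with $|r(x)-r(y)|\le -\frac{C_0}{\log(|x-y|)}$ for any $x,y$ with $|x-y|<\frac12$, and there are positive constants $r_\infty,C_\infty$ with $|r(x)-r_\infty|\le\frac{C_\infty}{\log(e+|x|)}$ for any $x\in\mathbb{R}^n$. For an exponent $q(\cdot)$ and a measurable function $f$, $\|f\|_{L^{q(\cdot)}}:=\inf\{\lambda\in(0,\infty):\int_{\mathbb{R}^n}|f(x)/\lambda|^{q(x)}\,dx\le1\}$.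 Cubes have finite edge length and edges parallel to the coordinate axes (not necessarily open or closed); $\fint_Q:=\frac1{|Q|}\int_Q$. A matrix weight is a function $W:\mathbb{R}^n\to M_m$ such that $W(x)$ is nonnegative definite and invertible for almost every $x$ and the entries of $W$ are all locally integrable. For an exponent $q(\cdot)$, $\mathscr{A}_{q(\cdot),\infty}$ is the class of matrix weights $W$ with $$[W]_{\mathscr{A}_{q(\cdot),\infty}}:=\sup_Q\exp\left(\fint_Q\log\left(\frac{1}{\|\mathbf{1}_Q\|_{L^{q(\cdot)}}}\left\|\,\|W(\cdot)W^{-1}(y)\|\,\mathbf{1}_Q(\cdot)\right\|_{L^{q(\cdot)}}\right)dy\right)<\infty,$$ the supremum being over all cubes $Q$ in $\mathbb{R}^n$; $\mathscr{A}_{1,\infty}$ is the case $q(\cdot)\equiv1$.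
   Formalization: In the ''if'' direction the constant C[W] in the inequality is replaced by some finite constant K independent of M and Q, since with [W] infinite the inequality is vacuous and that direction fails (e.g. p=2, W(x)=|x|^{-1/2}); the ''only if'' direction keeps C[W]. *)

(* Defs.v *)
From HB Require Import structures.
From mathcomp Require Import all_boot all_order all_algebra.
From mathcomp Require Import all_classical all_reals all_analysis measurable_realfun ess_sup_inf.
From mathcomp Require Import complex.

Set Implicit Arguments.
Unset Strict Implicit.
Unset Printing Implicit Defensive.

Import Order.TTheory GRing.Theory Num.Theory.
Import numFieldNormedType.Exports.

Local Open Scope classical_set_scope.
Local Open Scope ring_scope.

Section lebesgue_measure_in_dimension_n.
Context {R : realType}.
Local Notation Rb := (measurableTypeR R).

Definition cons_tuple_of n (z : Rb * n.-tuple Rb) : n.+1.-tuple Rb :=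
  [the n.+1.-tuple Rb of z.1 :: z.2].

Lemma measurable_cons_tuple_of n :
  measurable_fun [set: Rb * n.-tuple Rb] (@cons_tuple_of n).
Proof. exact: measurable_cons. Qed.

Section one_more_coordinate.
Variables (n : nat) (mu : {sigma_finite_measure set (n.-tuple Rb) -> \bar R}).

Definition cons_measure : set (n.+1.-tuple Rb) -> \bar R :=
  pushforward (lebesgue_measure \x mu)%E (@cons_tuple_of n).

Let cons_measure0 : cons_measure set0 = 0%E.
Proof. by rewrite /cons_measure /pushforward preimage_set0 measure0. Qed.

Let cons_measure_ge0 A : (0 <= cons_measure A)%E.
Proof. by rewrite /cons_measure /pushforward; exact: measure_ge0. Qed.

Let cons_measure_sigma_additive : semi_sigma_additive cons_measure.
Proof.
have pE : cons_measure = pushforward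
    ((lebesgue_measure \x mu)%E : {measure set (Rb * n.-tuple Rb) -> \bar R})
    (@cons_tuple_of n) by [].
move=> F mF tF mUF; rewrite pE /pushforward preimage_bigcup.
apply: measure_semi_sigma_additive.
- by move=> i; rewrite -[X in measurable X]setTI; exact: measurable_cons_tuple_of.
- apply/trivIsetP => /= i j _ _ ij; rewrite -preimage_setI.
  by move/trivIsetP : tF => /(_ _ _ _ _ ij) ->//; rewrite preimage_set0.
- rewrite -preimage_bigcup -[X in measurable X]setTI.
  exact: measurable_cons_tuple_of.
Qed.

HB.instance Definition _ := isMeasure.Build _ _ _ cons_measure
  cons_measure0 cons_measure_ge0 cons_measure_sigma_additive.

Let cons_measure_sigma_finite : sigma_finite setT cons_measure.
Proof.
have /sigma_finiteP[F [TF ndF Foo]] := sigma_finiteT (@lebesgue_measure R).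
have /sigma_finiteP[G [TG ndG Goo]] := sigma_finiteT mu.
pose g (t : n.+1.-tuple Rb) : Rb * n.-tuple Rb := (thead t, [tuple of behead t]).
have mg : measurable_fun [set: n.+1.-tuple Rb] g.
  apply/measurable_fun_pair; last exact: measurable_behead.
  exact: (@measurable_tnth _ _ n.+1 ord0).
have gK z : g (cons_tuple_of z) = z.
  by case: z => x t; rewrite /g theadE; congr pair; exact: val_inj.
exists (fun k => g @^-1` (F k `*` G k)) => [|k].
  rewrite -preimage_bigcup (_ : \bigcup_k (F k `*` G k) = setT) ?preimage_setT//.
  rewrite -setXTT TF TG predeqE => -[x y]; split.
    by move=> [k _ []/= ? ?]; split; exists k.
  move=> [/= [k _ Fkx] [l _ Gly]]; exists (maxn k l) => //; split.
  - by move: x Fkx; exact/subsetPset/ndF/leq_maxl.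
  - by move: y Gly; exact/subsetPset/ndG/leq_maxr.
have [mF Fk] := Foo k; have [mG Gk] := Goo k.
split.
  by rewrite -[X in measurable X]setTI; apply: mg => //; exact: measurableX.
rewrite /cons_measure /pushforward -comp_preimage.
rewrite (_ : g \o _ = id); last by apply/funext => z /=; rewrite gK.
by rewrite preimage_id product_measure1E// lte_mul_pinfty// ge0_fin_numE.
Qed.

HB.instance Definition _ := Measure_isSigmaFinite.Build _ _ _ cons_measure
  cons_measure_sigma_finite.

End one_more_coordinate.

(* The product on n.-tuple R of n copies of the Lebesgue measure, on the
   product (Borel) sigma-algebra. *)
Fixpoint borel_lebesgue n : {sigma_finite_measure set (n.-tuple Rb) -> \bar R} :=
  if n is n'.+1 then cons_measure (borel_lebesgue n')
  else \d_ ([tuple] : 0.-tuple Rb).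

End lebesgue_measure_in_dimension_n.

Arguments borel_lebesgue : clear implicits.

(* R^n with the sigma-algebra of Lebesgue measurable sets; the carrier is
   convertible to n.-tuple R. *)
Definition euclid (R : realType) (n : nat) : Type :=
  caratheodory_type (borel_lebesgue R n : set _ -> \bar R)^*%mu.
HB.instance Definition _ (R : realType) (n : nat) :=
  Measurable.on (euclid R n).

Definition lebesgue (R : realType) (n : nat) : set (euclid R n) -> \bar R :=
  @completed_measure_extension _ _ _ (borel_lebesgue R n).
HB.instance Definition _ (R : realType) (n : nat) := Measure.on (@lebesgue R n).

Arguments lebesgue : clear implicits.

Section euclidean_space.
Context {R : realType} {n : nat}.
Implicit Types (x y a : euclid R n) (Q : set (euclid R n)).

Definition ecoord x (i : 'I_n) : R := tnth (x : n.-tuple R) i.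

Definition enorm x : R := Num.sqrt (\sum_(i < n) ecoord x i ^+ 2).

Definition edist x y : R :=
  Num.sqrt (\sum_(i < n) (ecoord x i - ecoord y i) ^+ 2).

(* [b i] and [c i] decide whether the two ends of the i-th edge belong to Q. *)
Definition is_cube Q : Prop :=
  exists a (l : R) (b c : 'I_n -> bool), 0 < l /\
    Q = [set x | forall i, ecoord x i \in
           Interval (BSide (b i) (ecoord a i)) (BSide (c i) (ecoord a i + l))].

Definition average Q (f : euclid R n -> \bar R) : \bar R :=
  ((lebesgue R n Q)^-1 * \int[lebesgue R n]_(x in Q) f x)%E.

Definition exponent (p : euclid R n -> \bar R) : Prop :=
  measurable_fun [set: euclid R n] p /\ forall x, (1 <= p x)%E.

(* As [ln 0 = 0], the first inequality reads [0 <= 0] when x = y; this agrees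
   with the convention 1 / log 0 = 0. *)
Definition log_hoelder (r : euclid R n -> R) : Prop :=
  [/\ measurable_fun [set: euclid R n] r,
      exists2 C0 : R, 0 < C0 & forall x y, edist x y < 2^-1 ->
        `|r x - r y| <= - (C0 / ln (edist x y))
    & exists roo : R, exists2 Coo : R, 0 < roo /\ 0 < Coo & forall x,
        `|r x - roo| <= Coo / ln (expR 1 + enorm x)].

(* LH consists of real-valued functions. *)
Definition LH (p : euclid R n -> \bar R) : Prop :=
  exists2 r : euclid R n -> R, (forall x, p x = (r x)%:E) & log_hoelder r.

(* t ^ q for t >= 0 and q in [1, +oo], where t ^ +oo is 0 if t <= 1 and +oo
   otherwise; the value at q = -oo is irrelevant. *)
Definition epow (t : R) (q : \bar R) : \bar R :=
  match q with
  | r%:E => (t `^ r)%:E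
  | +oo%E => if t <= 1 then 0%E else +oo%E
  | -oo%E => 0%E
  end.

Definition varLnorm (q : euclid R n -> \bar R) (f : euclid R n -> R) : \bar R :=
  ereal_inf [set l%:E | l in [set l : R | 0 < l /\
    (\int[lebesgue R n]_x epow `|f x / l|%R (q x) <= 1)%E]].

Definition normalized_varLnorm (q : euclid R n -> \bar R) Q
    (f : euclid R n -> R) : \bar R :=
  ((varLnorm q \1_Q)^-1 * varLnorm q (fun x => f x * \1_Q x)%R)%E.

End euclidean_space.

Section complex_matrices.
Context {R : realType} {m : nat}.

Definition cvnorm (z : 'cV[R[i]]_m) : R :=
  Num.sqrt (\sum_(i < m) Normc.normc (z i 0) ^+ 2).

Definition opnorm (A : 'M[R[i]]_m) : R :=
  sup [set cvnorm (A *m z) | z in [set z | cvnorm z = 1]].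

(* In the order of R[i], [0 <= w] means that w is real and nonnegative. *)
Definition nonneg_definite (A : 'M[R[i]]_m) : Prop :=
  forall z : 'cV[R[i]]_m, 0 <= (map_mx Num.conj z^T *m A *m z) 0 0.

End complex_matrices.

Section matrix_weights.
Context {R : realType} {n m : nat}.
Implicit Types (W : euclid R n -> 'M[R[i]]_m) (q : euclid R n -> \bar R).

Definition locally_integrable_complex (f : euclid R n -> R[i]) : Prop :=
  forall E : set (euclid R n), measurable E ->
    (exists r : R, forall x, E x -> enorm x <= r) ->
    (lebesgue R n).-integrable E (fun x => (complex.Re (f x))%:E) /\
    (lebesgue R n).-integrable E (fun x => (complex.Im (f x))%:E).

Definition matrix_weight W : Prop :=
  {ae lebesgue R n, forall x, nonneg_definite (W x) /\ W x \in unitmx} /\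
  forall i j, locally_integrable_complex (fun x => W x i j).

Definition A_infty_const q W : \bar R :=
  ereal_sup [set expeR (average Q (fun y =>
      lne (normalized_varLnorm q Q (fun x => opnorm (W x *m invmx (W y))))))
    | Q in is_cube].

Definition A_infty q W : Prop :=
  matrix_weight W /\ (A_infty_const q W < +oo)%E.

(* K is a multiple of [A_infty_const q W] in the quantitative estimate. When the
   inequality is used to derive [A_infty_const q W < +oo], K has to be finite:
   the inequality holds trivially if K = +oo. *)
Definition reverse_hoelder q W (K : \bar R) : Prop :=
  forall (M : 'M[R[i]]_m) (Q : set (euclid R n)), is_cube Q ->
    (normalized_varLnorm q Q (fun x => opnorm (W x *m M)) <=
     K * average Q (fun x => (opnorm (W x *m M))%:E))%E.

End matrix_weights.

(* Main.v *)
Require Import Defs.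
From mathcomp Require Import all_boot all_order all_algebra.
From mathcomp Require Import all_classical all_reals all_analysis measurable_realfun ess_sup_inf.
From mathcomp Require Import complex ring lra.

Set Implicit Arguments.
Unset Strict Implicit.
Unset Printing Implicit Defensive.

Import Order.TTheory GRing.Theory Num.Theory.
Import numFieldNormedType.Exports.

Local Open Scope classical_set_scope.
Local Open Scope ring_scope.

(** For an exponent q and a cube Q, let N_q(M) be the normalised norm of
    x |-> ||W(x) M|| on Q, and let w_q(y) = N_q(W(y)^-1); the weight class of
    exponent q asks that exp of the mean of ln w_q over Q be bounded, uniformly
    in Q. Everything rests on two inequalities.

    The first is ||W(x) M|| <= ||W(x) W(y)^-1|| ||W(y) M||. Taking norms in x gives
    N_q(M) <= w_q(y) ||W(y) M|| for almost every y. Taking logarithms, averaging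
    over y and applying Jensen's inequality to the last factor, one obtains
      N_q(M) <= exp (mean of ln w_q) * (mean of ||W M||),
    the reverse Hoelder inequality with constant 1
    ([normalized_weight_le_exp_average]). Jensen's inequality is used in the form
    of the tangent bound ln g <= g / a - 1 + ln a, where a is the mean of g.

    The second is w_1 <= C w_p, that is: the mean of a function over a cube is at
    most C times its normalised variable norm ([log_hoelder_average_le]). This is
    where log-Hoelder continuity and p_- > 1 are used. At the scale of a cube of
    measure V the exponent is nearly a constant q, meaning that |ln V| |p - q| is
    bounded, so that V^(p/q) and V are comparable. For small cubes q is the value
    of p at a corner. For the other cubes it is the limit of p at infinity, which
    is greater than 1. When the cube is large, one discards its part near the
    origin, of measure at most a constant times min(V^(1/q), V^(1-1/q)), a bound
    that grows with V because q > 1. Given this, the elementary inequality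
    u <= t + u^s t^(1-s) with t = V^(-1/q) bounds the mean of every function of
    modular at most 1.

    Thus w_1 <= C w_p carries the class of exponent p into that of exponent 1, and
    a reverse Hoelder inequality with a finite constant K, which says w_p <= K w_1
    when M = W(y)^-1, carries it back.

    The measurability of w_p is avoided: integrals are compared by
    [ae_le_integral], valid for arbitrary functions, and constants are pulled out
    of the mean of ln w_1 only. The latter is measurable because the mean of
    ||W M|| is Lipschitz in M, and integrable because the tangent bound provides
    an integrable lower bound. *)

Local Notation normc := (Normc.normc).

(** * Integrals of arbitrary functions *)

Section integral_without_measurability.
Local Open Scope ereal_scope.
Context d (T : measurableType d) (R : realType).
Variable mu : {measure set T -> \bar R}.
Import HBNNSimple.

(** The integral of a nonnegative function is a supremum over the simple
    functions below it, and a simple function can be set to 0 on a null set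
    without changing its integral; so monotonicity almost everywhere asks for
    no measurability. This matters below because integrands such as the
    logarithm of y |-> N_p(W(y)^-1) are treated as arbitrary functions. *)
Lemma ge0_ae_le_integralT (f g : T -> \bar R) :
  (forall x, 0 <= f x) -> (forall x, 0 <= g x) ->
  {ae mu, forall x, f x <= g x} -> \int[mu]_x f x <= \int[mu]_x g x.
Proof.
move=> f0 g0 [N [mN muN fgN]].
rewrite ge0_integralTE// ge0_integralTE//.
apply: ge_ereal_sup => _ /= [h hf <-].
pose h' : {nnsfun T >-> R} := proj_nnsfun h (measurableC mN).
apply: ereal_sup_ubound; exists h' => [/= x|].
  rewrite /h' /= mindicE; have [xN|xN] := boolP (x \in ~` N).
    rewrite mulr1 (le_trans (hf x))//.
    by apply: contrapT => /fgN Nx; move: xN; rewrite inE.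
  by rewrite mulr0.
rewrite -!integralT_nnsfun.
apply: ae_eq_integral => //.
- by apply/measurable_EFinP; apply: measurable_funP.
- by apply/measurable_EFinP; apply: measurable_funP.
exists N; split => // x /= /not_implyP[_ hh]; apply: contrapT => xN.
by apply: hh; rewrite mindicE mem_set// mulr1.
Qed.

Lemma ge0_ae_le_integral (D : set T) (f g : T -> \bar R) :
  (forall x, 0 <= f x) -> (forall x, 0 <= g x) ->
  {ae mu, forall x, D x -> f x <= g x} ->
  \int[mu]_(x in D) f x <= \int[mu]_(x in D) g x.
Proof.
move=> f0 g0 fg; rewrite (integral_mkcond D) [leRHS](integral_mkcond D).
apply: ge0_ae_le_integralT => [x|x|]; [exact: erestrict_ge0..|].
by apply: filterS fg => x fg; rewrite !patchE; case: ifPn => //; rewrite inE => /fg.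
Qed.

(** When both the positive and the negative part have infinite integral, the
    difference is -oo; the bound still holds, because subtraction of extended
    reals is monotone with this convention. *)
Lemma ae_le_integral (D : set T) (f g : T -> \bar R) :
  {ae mu, forall x, D x -> f x <= g x} ->
  \int[mu]_(x in D) f x <= \int[mu]_(x in D) g x.
Proof.
move=> fg; rewrite integralE [leRHS]integralE.
apply: leeB; apply: ge0_ae_le_integral => //;
  apply: filterS fg => x fg /fg {}fg.
- by rewrite !funeposE ge_max !le_max fg lexx orbT.
- by rewrite !funenegE ge_max !le_max leeN2 fg lexx orbT.
Qed.

(** The upper bound u may fail to be measurable: its negative part is
    controlled by that of l, so the finiteness of its integral bounds its
    positive part, hence the positive part of f. *)
Lemma integrable_between (D : set T) (l f u : T -> \bar R) : measurable D ->
  measurable_fun D f -> mu.-integrable D l ->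
  {ae mu, forall x, D x -> l x <= f x} -> {ae mu, forall x, D x -> f x <= u x} ->
  \int[mu]_(x in D) u x < +oo -> mu.-integrable D f.
Proof.
move=> mD mf il lf fu; have mfp := measurable_funepos mf.
have mfn := measurable_funeneg mf.
have fnlt : \int[mu]_(x in D) f^\- x < +oo.
  apply: le_lt_trans (integral_funeneg_lt_pinfty mD il).
  apply: ge0_ae_le_integral => //; apply: filterS lf => x lf /lf {}lf.
  by rewrite !funenegE ge_max !le_max leeN2 lf lexx orbT.
have unlt : \int[mu]_(x in D) u^\- x < +oo.
  apply: le_lt_trans fnlt.
  apply: ge0_ae_le_integral => //; apply: filterS fu => x fu /fu {}fu.
  by rewrite !funenegE ge_max !le_max leeN2 fu lexx orbT.
rewrite integralE => ult.
have uplt : \int[mu]_(x in D) u^\+ x < +oo.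
  move: ult unlt; have : 0 <= \int[mu]_(x in D) u^\- x by apply: integral_ge0.
  case: (\int[mu]_(x in D) u^\- x) => [r||] _;
    by case: (\int[mu]_(x in D) u^\+ x) => [r'||]; rewrite ?ltry.
have fplt : \int[mu]_(x in D) f^\+ x < +oo.
  apply: le_lt_trans uplt.
  apply: ge0_ae_le_integral => //; apply: filterS fu => x fu /fu {}fu.
  by rewrite !funeposE ge_max !le_max fu lexx orbT.
apply/integrableP; split => //.
rewrite (eq_integral (fun x => f^\+ x + f^\- x)); last first.
  by move=> x _; rewrite -[LHS]/((abse \o f) x) fune_abse.
by rewrite ge0_integralD// lte_add_pinfty.
Qed.
End integral_without_measurability.

(** * The operator norm of complex matrices *)

Section euclidean_norm.
Variables (R : realType) (I : finType).
Implicit Types a b : I -> R.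

(** Cauchy-Schwarz, from the nonnegativity of the sum of the squares
    (t a_i - s b_i)^2, where s and t are the norms of a and b. *)
Lemma sum_mul_le_sqrt a b : \sum_i a i * b i <=
  Num.sqrt (\sum_i a i ^+ 2) * Num.sqrt (\sum_i b i ^+ 2).
Proof.
set s := Num.sqrt _; set t := Num.sqrt _.
have s2 : s ^+ 2 = \sum_i a i ^+ 2 by rewrite sqr_sqrtr// sumr_ge0// => i _; exact: sqr_ge0.
have t2 : t ^+ 2 = \sum_i b i ^+ 2 by rewrite sqr_sqrtr// sumr_ge0// => i _; exact: sqr_ge0.
have s0 : 0 <= s by exact: sqrtr_ge0.
have t0 : 0 <= t by exact: sqrtr_ge0.
have zero (c : I -> R) : (\sum_i c i ^+ 2 == 0 :> R) -> forall i, c i = 0.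
  rewrite psumr_eq0; last by move=> i _; exact: sqr_ge0.
  by move=> /allP h i; apply/eqP; rewrite -sqrf_eq0; apply: h; rewrite mem_index_enum.
have [s00|sn0] := eqVneq s 0.
  rewrite s00 mul0r big1// => i _; rewrite (zero a) ?mul0r//.
  by rewrite -s2 s00 expr0n.
have [t00|tn0] := eqVneq t 0.
  rewrite t00 mulr0 big1// => i _; rewrite (zero b) ?mulr0//.
  by rewrite -t2 t00 expr0n.
have st0 : 0 < s * t by rewrite mulr_gt0// lt0r ?sn0 ?tn0.
have : 0 <= \sum_i (t * a i - s * b i) ^+ 2.
  by apply: sumr_ge0 => i _; exact: sqr_ge0.
have -> : \sum_i (t * a i - s * b i) ^+ 2 =
    t ^+ 2 * \sum_i a i ^+ 2 - 2 * (s * t) * \sum_i (a i * b i)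
    + s ^+ 2 * \sum_i b i ^+ 2.
  by rewrite !mulr_sumr -sumrB -big_split; apply: eq_bigr => i _ /=; ring.
rewrite -s2 -t2 => h; rewrite -(ler_pM2l st0); nra.
Qed.

Lemma sqrt_sum_triangle a b : Num.sqrt (\sum_i (a i + b i) ^+ 2) <=
  Num.sqrt (\sum_i a i ^+ 2) + Num.sqrt (\sum_i b i ^+ 2).
Proof.
have ge0 (c : I -> R) : 0 <= \sum_i c i ^+ 2 :> R.
  by apply: sumr_ge0 => i _; exact: sqr_ge0.
rewrite -ler_sqr ?nnegrE ?addr_ge0 ?sqrtr_ge0//.
rewrite sqrrD !sqr_sqrtr//.
have -> : \sum_i (a i + b i) ^+ 2 =
    \sum_i a i ^+ 2 + 2 * (\sum_i a i * b i) + \sum_i b i ^+ 2.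
  by rewrite mulr_sumr -!big_split; apply: eq_bigr => i _ /=; ring.
by rewrite lerD2r lerD2l mulr2n mulrDl mul1r lerD// sum_mul_le_sqrt.
Qed.

Lemma sqrt_sum_le_sum a : (forall i, 0 <= a i) ->
  Num.sqrt (\sum_i a i ^+ 2) <= \sum_i a i.
Proof.
move=> a0; have s0 : 0 <= \sum_i a i by exact: sumr_ge0.
rewrite -(ger0_norm s0) -sqrtr_sqr ler_sqrt ?sqr_ge0//.
rewrite [leRHS]expr2 mulr_sumr; apply: ler_sum => i _.
rewrite expr2 ler_wpM2r// (bigD1 i)//= lerDl; exact: sumr_ge0.
Qed.

Lemma le_sqrt_sum a i : (forall i, 0 <= a i) -> a i <= Num.sqrt (\sum_i a i ^+ 2).
Proof.
move=> a0; rewrite -(ger0_norm (a0 i)) -sqrtr_sqr ler_wsqrtr// (bigD1 i)//= lerDl.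
by apply: sumr_ge0 => j _; exact: sqr_ge0.
Qed.

End euclidean_norm.

Section operator_norm.
Variables (R : realType) (m : nat).
Hypothesis m_gt0 : (0 < m)%N.
Implicit Types (A B : 'M[R[i]]_m) (z w : 'cV[R[i]]_m).

Lemma normc_ge0 (x : R[i]) : 0 <= normc x.
Proof. by case: x => a b; exact: sqrtr_ge0. Qed.

Lemma cvnorm_ge0 z : 0 <= cvnorm z.
Proof. exact: sqrtr_ge0. Qed.

Lemma cvnorm_triangle z w : cvnorm (z + w) <= cvnorm z + cvnorm w.
Proof.
apply: le_trans (sqrt_sum_triangle _ _).
rewrite ler_wsqrtr//; apply: ler_sum => i _; rewrite mxE.
by rewrite ler_sqr ?nnegrE ?addr_ge0 ?normc_ge0// le_normcD.
Qed.

Lemma cvnormZ (c : R[i]) z : cvnorm (c *: z) = normc c * cvnorm z.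
Proof.
rewrite /cvnorm -[X in X * _](ger0_norm (normc_ge0 c)) -sqrtr_sqr.
rewrite -sqrtrM ?sqr_ge0//; congr Num.sqrt.
by rewrite mulr_sumr; apply: eq_bigr => i _; rewrite mxE Normc.normcM exprMn.
Qed.

Lemma cvnorm_eq0 z : cvnorm z = 0 -> z = 0.
Proof.
move=> z0; apply/colP => i; rewrite mxE; apply: Normc.eq0_normc.
apply/le_anti; rewrite normc_ge0 andbT -z0.
by apply: (le_sqrt_sum (a := fun i => normc (z i 0))) => j; exact: normc_ge0.
Qed.

Lemma cvnorm_delta (j : 'I_m) : cvnorm (delta_mx j 0 : 'cV[R[i]]_m) = 1.
Proof.
rewrite /cvnorm (bigD1 j)//= mxE !eqxx Normc.normc1 big1 ?addr0 ?expr1n ?sqrtr1//.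
by move=> i ij; rewrite mxE (negbTE ij) Normc.normc0 expr0n.
Qed.

(** An upper bound for the operator norm, which shows in particular that the
    supremum defining the latter is over a bounded set. *)
Definition entry_norm A := \sum_i \sum_j normc (A i j).

Lemma normc_sum (I : finType) (F : I -> R[i]) :
  normc (\sum_i F i) <= \sum_i normc (F i).
Proof.
elim/big_rec2 : _ => [|i y x _ xy]; first by rewrite Normc.normc0.
by apply: le_trans (le_normcD _ _) _; rewrite lerD2l.
Qed.

Lemma cvnorm_mulmx_le A z : cvnorm z = 1 -> cvnorm (A *m z) <= entry_norm A.
Proof.
move=> z1; apply: (le_trans (sqrt_sum_le_sum _)) => [i|]; first exact: normc_ge0.
apply: ler_sum => i _; rewrite mxE; apply: le_trans (normc_sum _) _.
apply: ler_sum => j _; rewrite Normc.normcM ler_piMr ?normc_ge0// -z1.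
by apply: (le_sqrt_sum (a := fun i => normc (z i 0))) => k; exact: normc_ge0.
Qed.

Lemma opnorm_has_sup A :
  has_sup [set cvnorm (A *m z) | z in [set z | cvnorm z = 1]].
Proof.
split.
  exists (cvnorm (A *m delta_mx (Ordinal m_gt0) 0)).
  by exists (delta_mx (Ordinal m_gt0) 0) => //; exact: cvnorm_delta.
by exists (entry_norm A) => _ [z z1 <-]; exact: cvnorm_mulmx_le.
Qed.

Lemma opnorm_le A c : (forall z, cvnorm z = 1 -> cvnorm (A *m z) <= c) ->
  opnorm A <= c.
Proof.
move=> h; apply: ge_sup; first by case: (opnorm_has_sup A).
by move=> _ [z z1 <-]; exact: h.
Qed.

Lemma cvnorm_mulmx A z : cvnorm (A *m z) <= opnorm A * cvnorm z.
Proof.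
have [/cvnorm_eq0 ->|zn0] := eqVneq (cvnorm z) 0.
  by rewrite mulmx0 -(scale0r 0) cvnormZ Normc.normc0 !mul0r mulr0.
have z0 : 0 < cvnorm z by rewrite lt0r zn0 cvnorm_ge0.
pose c : R[i] := Complex ((cvnorm z)^-1) 0.
have nc : normc c = (cvnorm z)^-1.
  by rewrite /c /= expr0n /= addr0 sqrtr_sqr ger0_norm// invr_ge0 cvnorm_ge0.
rewrite -ler_pdivrMr// mulrC -nc -cvnormZ scalemxAr.
apply: sup_upper_bound; first exact: opnorm_has_sup.
by exists (c *: z) => //=; rewrite cvnormZ nc mulVf.
Qed.

Lemma opnorm_ge0 A : 0 <= opnorm A.
Proof.
apply: le_trans (cvnorm_ge0 (A *m delta_mx (Ordinal m_gt0) 0)) _.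
by rewrite -[leRHS]mulr1 -(cvnorm_delta (Ordinal m_gt0)) cvnorm_mulmx.
Qed.

Lemma opnorm_eq0 A : opnorm A = 0 -> A = 0.
Proof.
move=> A0; apply/matrixP => i j; rewrite mxE.
have /colP/(_ i) : A *m (delta_mx j 0 : 'cV_m) = 0.
  apply/cvnorm_eq0/le_anti; rewrite cvnorm_ge0 andbT.
  by apply: le_trans (cvnorm_mulmx _ _) _; rewrite A0 mul0r.
by rewrite -colE !mxE.
Qed.

Lemma opnorm_le_entry A : opnorm A <= entry_norm A.
Proof. by apply: opnorm_le => z; exact: cvnorm_mulmx_le. Qed.

Lemma opnormM A B : opnorm (A *m B) <= opnorm A * opnorm B.
Proof.
apply: opnorm_le => z z1; rewrite -mulmxA.
apply: le_trans (cvnorm_mulmx _ _) _; rewrite ler_wpM2l ?opnorm_ge0//.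
by apply: le_trans (cvnorm_mulmx _ _) _; rewrite z1 mulr1.
Qed.

Lemma opnormD A B : opnorm (A + B) <= opnorm A + opnorm B.
Proof.
apply: opnorm_le => z z1; rewrite mulmxDl.
apply: le_trans (cvnorm_triangle _ _) _.
by apply: lerD; apply: le_trans (cvnorm_mulmx _ _) _; rewrite z1 mulr1.
Qed.

Lemma opnorm0 : opnorm (0 : 'M[R[i]]_m) = 0.
Proof.
apply/le_anti; rewrite opnorm_ge0 andbT.
apply: le_trans (opnorm_le_entry _) _; rewrite /entry_norm big1// => i _.
by rewrite big1// => j _; rewrite mxE Normc.normc0.
Qed.

Lemma opnorm_le_dist A B : opnorm A <= opnorm B + opnorm (A - B).
Proof. by apply: le_trans (opnormD _ _); rewrite addrC subrK. Qed.

End operator_norm.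

(** * Measurable functions of complex matrices *)

Section measurability_of_matrix_functions.
Context d (T : measurableType d) (R : realType) (D : set T).
Implicit Types f g : T -> R[i].

Definition cmeasurable_fun f :=
  measurable_fun D (fun x => complex.Re (f x)) /\
  measurable_fun D (fun x => complex.Im (f x)).

Lemma eq_cmeasurable f g : f =1 g -> cmeasurable_fun f -> cmeasurable_fun g.
Proof. by move=> /funext ->. Qed.

Lemma cmeasurable_cst c : cmeasurable_fun (cst c).
Proof. by split; exact: measurable_cst. Qed.

Lemma cmeasurableD f g : cmeasurable_fun f -> cmeasurable_fun g ->
  cmeasurable_fun (fun x => f x + g x).
Proof.
move=> [fr fi] [gr gi]; split.
- apply: eq_measurable_fun (measurable_funD fr gr) => x _ /=.
  by case: (f x) (g x) => [? ?] [? ?].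
- apply: eq_measurable_fun (measurable_funD fi gi) => x _ /=.
  by case: (f x) (g x) => [? ?] [? ?].
Qed.

Lemma cmeasurableM f g : cmeasurable_fun f -> cmeasurable_fun g ->
  cmeasurable_fun (fun x => f x * g x).
Proof.
move=> [fr fi] [gr gi]; split.
- apply: eq_measurable_fun (measurable_funB (measurable_funM fr gr)
    (measurable_funM fi gi)) => x _ /=.
  by case: (f x) (g x) => [? ?] [? ?].
- apply: eq_measurable_fun (measurable_funD (measurable_funM fr gi)
    (measurable_funM fi gr)) => x _ /=.
  by case: (f x) (g x) => [? ?] [? ?].
Qed.

(** The inverse of a complex number is its conjugate divided by the squared
    modulus; the real inverse is obtained as the power of exponent -1, which
    has the right value 0 at 0. *)
Lemma cmeasurableV f : cmeasurable_fun f -> cmeasurable_fun (fun x => (f x)^-1).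
Proof.
move=> [fr fi].
pose n2 := fun x => (complex.Re (f x) ^+ 2 + complex.Im (f x) ^+ 2) `^ (-1).
have mn : measurable_fun D n2.
  apply: (measurableT_comp (measurable_powR (R := R) (- 1))).
  by apply: measurable_funD; apply: measurable_funX.
have nE x : n2 x = (complex.Re (f x) ^+ 2 + complex.Im (f x) ^+ 2)^-1.
  by rewrite /n2 powR_inv1// addr_ge0// sqr_ge0.
split.
- apply: eq_measurable_fun (measurable_funM fr mn) => x _ /=; rewrite nE.
  by case: (f x) => [? ?].
- apply: eq_measurable_fun (measurable_funN (measurable_funM fi mn)) => x _ /=.
  by rewrite nE; case: (f x) => [? ?].
Qed.

Lemma cmeasurable_sum (I : Type) (s : seq I) (P : pred I) (F : I -> T -> R[i]) :
  (forall i, cmeasurable_fun (F i)) ->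
  cmeasurable_fun (fun x => \sum_(i <- s | P i) F i x).
Proof.
move=> mF; elim: s => [|i s ih].
  by apply: eq_cmeasurable (cmeasurable_cst _) => x; rewrite big_nil.
have [Pi|Pi] := boolP (P i).
  by apply: eq_cmeasurable (cmeasurableD (mF i) ih) => x; rewrite big_cons Pi.
by apply: eq_cmeasurable ih => x; rewrite big_cons (negbTE Pi).
Qed.

Lemma cmeasurable_prod (I : Type) (s : seq I) (P : pred I) (F : I -> T -> R[i]) :
  (forall i, cmeasurable_fun (F i)) ->
  cmeasurable_fun (fun x => \prod_(i <- s | P i) F i x).
Proof.
move=> mF; elim: s => [|i s ih].
  by apply: eq_cmeasurable (cmeasurable_cst _) => x; rewrite big_nil.
have [Pi|Pi] := boolP (P i).
  by apply: eq_cmeasurable (cmeasurableM (mF i) ih) => x; rewrite big_cons Pi.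
by apply: eq_cmeasurable ih => x; rewrite big_cons (negbTE Pi).
Qed.

Lemma cmeasurable_det m (F : T -> 'M[R[i]]_m) :
  (forall i j, cmeasurable_fun (fun x => F x i j)) ->
  cmeasurable_fun (fun x => \det (F x)).
Proof.
move=> mF; apply: cmeasurable_sum => s; apply: cmeasurableM.
  exact: cmeasurable_cst.
by apply: cmeasurable_prod => i; exact: mF.
Qed.

Lemma cmeasurable_adj m (F : T -> 'M[R[i]]_m) :
  (forall i j, cmeasurable_fun (fun x => F x i j)) ->
  forall i j, cmeasurable_fun (fun x => \adj (F x) i j).
Proof.
move=> mF i j.
apply: (@eq_cmeasurable (fun x => (-1) ^+ (j + i) * \det (row' j (col' i (F x))))).
  by move=> x; rewrite mxE.
apply: cmeasurableM; first exact: cmeasurable_cst.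
apply: cmeasurable_det => k l.
by apply: eq_cmeasurable (mF (lift j k) (lift i l)) => x; rewrite !mxE.
Qed.

(** Unlike [entry_norm], this norm is visibly a measurable function of the real
    and imaginary parts, and its balls contain matrices with rational parts. *)
Definition l1norm m (A : 'M[R[i]]_m) : R :=
  \sum_i \sum_j (`|complex.Re (A i j)| + `|complex.Im (A i j)|).

Lemma l1norm_ge0 m (A : 'M[R[i]]_m) : 0 <= l1norm A.
Proof. by do 2!apply: sumr_ge0 => ? _; rewrite addr_ge0. Qed.

Lemma entry_norm_le_l1norm m (A : 'M[R[i]]_m) : entry_norm A <= l1norm A.
Proof.
apply: ler_sum => i _; apply: ler_sum => j _; case: (A i j) => a b /=.
have h : 0 <= `|a| + `|b| by rewrite addr_ge0.
rewrite -[leRHS]ger0_norm// -sqrtr_sqr ler_wsqrtr// sqrrD !real_normK ?num_real//.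
by rewrite -addrA lerD2l lerDr mulrn_wge0// mulr_ge0.
Qed.

Lemma measurable_l1norm m (F : T -> 'M[R[i]]_m) :
  (forall i j, cmeasurable_fun (fun x => F x i j)) ->
  measurable_fun D (fun x => l1norm (F x)).
Proof.
move=> mF; apply: measurable_sum => i; apply: measurable_sum => j.
by case: (mF i j) => mr mi; apply: measurable_funD; exact: measurableT_comp.
Qed.

Definition rat_matrix m (B : 'M[rat]_m * 'M[rat]_m) : 'M[R[i]]_m :=
  \matrix_(i, j) Complex (ratr (B.1 i j)) (ratr (B.2 i j)).

Lemma rat_matrix_dense m (A : 'M[R[i]]_m) (e : R) : 0 < e ->
  exists B, l1norm (A - rat_matrix B) < e.
Proof.
move=> e0.
pose k : R := (m * m)%:R + 1.
have k0 : 0 < k by rewrite /k ltr_wpDl.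
have near (x : R) : {q : rat | `|x - ratr q| < e / k / 2}.
  have h : x - e / k / 2 < x + e / k / 2.
    by rewrite ltrD2l gtrN// !divr_gt0.
  apply: cid; have [q] := rat_in_itvoo h; rewrite in_itv /= => /andP[q1 q2].
  by exists q; rewrite ltr_distlC; apply/andP; split; lra.
exists (\matrix_(i, j) sval (near (complex.Re (A i j))),
        \matrix_(i, j) sval (near (complex.Im (A i j)))).
apply: (@le_lt_trans _ _ (\sum_(i < m) \sum_(j < m) e / k)).
  apply: ler_sum => i _; apply: ler_sum => j _; rewrite !mxE.
  have := svalP (near (complex.Re (A i j))); have := svalP (near (complex.Im (A i j))).
  case: (near _) (near _) => q1 /= _ [q2 /= _].
  case: (A i j) => a b /= h1 h2; lra.
rewrite !sumr_const !card_ord -mulrnA -mulr_natl mulrCA gtr_pMr//.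
by rewrite ltr_pdivrMr// mul1r /k ltrDl.
Qed.

(** A Lipschitz function g is the infimum of the cones
    g B + L * l1norm (A - B) over the countably many rational matrices B, so
    that its sublevel sets along F are countable unions of measurable sets. *)
Lemma measurable_lipschitz_matrix m (g : 'M[R[i]]_m -> R) (L : R)
    (F : T -> 'M[R[i]]_m) : 0 <= L ->
  (forall A B, g A <= g B + L * l1norm (A - B)) ->
  (forall i j, cmeasurable_fun (fun x => F x i j)) ->
  measurable_fun D (fun x => g (F x)).
Proof.
move=> L0 gL mF mD; apply: (measurability _ (RGenInftyO.measurableE R)) => //.
move=> _ [_ [a ->] <-].
pose E (B : 'M[rat]_m * 'M[rat]_m) :=
  D `&` [set x | L * l1norm (F x - rat_matrix B) + g (rat_matrix B) < a].
rewrite (_ : _ `&` _ = \bigcup_B E B); last first.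
  apply/seteqP; split=> [x [Dx]|x [B _ [Dx /= h]]]; last first.
    split => //=; rewrite in_itv /=; apply: le_lt_trans h.
    by rewrite addrC; exact: gL.
  rewrite /= in_itv /= => gFa.
  (* the Lipschitz bound is used twice, from F x to B and back *)
  pose e := (a - g (F x)) / (2 * L + 1).
  have k0 : 0 < 2 * L + 1 by rewrite ltr_wpDl// mulr_ge0.
  have e0 : 0 < e by rewrite divr_gt0// subr_gt0.
  have [B hB] := rat_matrix_dense (F x) e0.
  exists B => //; split => //=.
  have l1sym : l1norm (rat_matrix B - F x) = l1norm (F x - rat_matrix B).
    apply: eq_bigr => i _; apply: eq_bigr => j _; rewrite !mxE.
    by case: (F x i j) => u v /=; congr (_ + _); exact: distrC.
  have := gL (rat_matrix B) (F x); rewrite l1sym.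
  have : e * (2 * L + 1) = a - g (F x) by rewrite /e divfK// gt_eqF.
  have := l1norm_ge0 (F x - rat_matrix B); nra.
apply: countable_bigcupT_measurable => [|B]; first exact: countableP.
rewrite /E; suff : measurable_fun D
    (fun x => L * l1norm (F x - rat_matrix B) + g (rat_matrix B)).
  move=> mh; have := mh mD `]-oo, a[%classic (measurable_itv `]-oo, a[).
  by congr (measurable (_ `&` _)); apply/seteqP; split => x /=; rewrite in_itv.
apply: measurable_funD; last exact: measurable_cst.
apply: measurable_funM; first exact: measurable_cst.
apply: measurable_l1norm => i j.
by apply: eq_cmeasurable (cmeasurableD (mF i j)
  (cmeasurable_cst (- rat_matrix B i j))) => x; rewrite !mxE.
Qed.

Lemma cmeasurable_mulmxr m (F : T -> 'M[R[i]]_m) (M : 'M[R[i]]_m) :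
  (forall i j, cmeasurable_fun (fun x => F x i j)) ->
  forall i j, cmeasurable_fun (fun x => (F x *m M) i j).
Proof.
move=> mF i j.
apply: (@eq_cmeasurable (fun x => \sum_k F x i k * M k j)) => [x|].
  by rewrite mxE.
apply: cmeasurable_sum => k; apply: cmeasurableM => //; exact: cmeasurable_cst.
Qed.

Lemma measurable_opnorm m (F : T -> 'M[R[i]]_m) : (0 < m)%N ->
  (forall i j, cmeasurable_fun (fun x => F x i j)) ->
  measurable_fun D (fun x => opnorm (F x)).
Proof.
move=> m0; apply: (measurable_lipschitz_matrix (L := 1)) => // A B.
rewrite mul1r; apply: le_trans (opnorm_le_dist m0 A B) _; rewrite lerD2l.
exact: le_trans (opnorm_le_entry m0 _) (entry_norm_le_l1norm _).
Qed.
End measurability_of_matrix_functions.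

(** * Lebesgue measure of cubes *)

Section cubes.
Variable R : realType.
Local Notation Rb := (measurableTypeR R).

Definition box n (J : 'I_n -> interval R) : set (n.-tuple Rb) :=
  [set x | forall i, tnth x i \in J i].

Lemma measurable_box n (J : 'I_n -> interval R) : measurable (box J).
Proof.
rewrite (_ : box J = \bigcap_(i in [set: 'I_n]) (fun x => tnth x i) @^-1` [set` J i]).
  apply: fin_bigcap_measurable => // i _.
  rewrite -[X in measurable X]setTI.
  by apply: (@measurable_tnth _ Rb n i) => //; exact: measurable_itv.
by apply/seteqP; split => [x xJ i _|x xJ i]; exact: xJ.
Qed.

Lemma borel_lebesgue_box n (J : 'I_n -> interval R) (v : 'I_n -> R) :
  (forall i, lebesgue_measure [set` J i] = (v i)%:E) ->
  borel_lebesgue R n (box J) = (\prod_i v i)%:E.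
Proof.
elim: n J v => [|n ih] J v Jv.
  rewrite big_ord0 /= diracE mem_set//; by case.
rewrite big_ord_recl EFinM -(Jv ord0) -(ih (fun i => J (lift ord0 i))); last by [].
rewrite -product_measure1E; [|exact: measurable_itv|exact: measurable_box].
rewrite /= /cons_measure /pushforward; congr (_ _).
apply/seteqP; split => [[x t] /= h|[x t] /= [h1 h2] i].
  split => [|i /=]; first by have := h ord0; rewrite tnth0.
  by have := h (lift ord0 i); rewrite tnthS.
by case: (unliftP ord0 i) => [j|] ->; rewrite ?tnthS ?tnth0//; exact: h2.
Qed.

(** Lebesgue measure is the completion of the product Borel measure, with which
    it agrees on Borel sets. *)
Lemma lebesgue_measurable n (A : set (n.-tuple Rb)) : measurable A ->
  measurable (A : set (euclid R n)) /\ lebesgue R n A = borel_lebesgue R n A.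
Proof.
move=> mA; split; first exact: caratheodory_measurable_mu_ext.
by rewrite /lebesgue /completed_measure_extension measurable_mu_extE.
Qed.

Variable n : nat.

Lemma enorm_le_sum (x : euclid R n) : enorm x <= \sum_i `|ecoord x i|.
Proof.
rewrite /enorm; under eq_bigr do rewrite -real_normK ?num_real//.
exact: sqrt_sum_le_sum.
Qed.

Lemma ecoord_le_enorm (x : euclid R n) i : `|ecoord x i| <= enorm x.
Proof.
rewrite /enorm; under eq_bigr do rewrite -real_normK ?num_real//.
exact: (le_sqrt_sum (a := fun i => `|ecoord x i|)).
Qed.

Definition cube (a : euclid R n) (l : R) (b c : 'I_n -> bool) : set (euclid R n) :=
  [set x | forall i, ecoord x i \in
           Interval (BSide (b i) (ecoord a i)) (BSide (c i) (ecoord a i + l))].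

Lemma cube_coord a l b c x : cube a l b c x ->
  forall i, ecoord a i <= ecoord x i <= ecoord a i + l.
Proof.
move=> xQ i; have := xQ i; rewrite itv_boundlr => /andP[].
by case: (b i) (c i) => [] [] /=; rewrite !bnd_simp => h1 h2;
  rewrite ?h1 ?h2 ?(ltW h1) ?(ltW h2).
Qed.

Lemma measurable_cube a l b c : measurable (cube a l b c).
Proof. by have [] := lebesgue_measurable (measurable_box
  (fun i => Interval (BSide (b i) (ecoord a i)) (BSide (c i) (ecoord a i + l)))). Qed.

Lemma lebesgue_cube a l b c : 0 < l -> lebesgue R n (cube a l b c) = (l ^+ n)%:E.
Proof.
move=> l0; have [_ ->] := lebesgue_measurable (measurable_box
  (fun i => Interval (BSide (b i) (ecoord a i)) (BSide (c i) (ecoord a i + l)))).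
rewrite (borel_lebesgue_box (v := fun=> l)) ?prodr_const ?card_ord// => i.
rewrite lebesgue_measure_itv /= lte_fin ltrDl l0 -EFinB; congr EFin; ring.
Qed.

Lemma bounded_cube a l b c : exists r, forall x, cube a l b c x -> enorm x <= r.
Proof.
exists (\sum_i (`|ecoord a i| + `|l|)) => x xQ.
apply: le_trans (enorm_le_sum x) _; apply: ler_sum => i _.
have /andP[h1 h2] := cube_coord xQ i.
rewrite ler_norml; apply/andP; split.
  have := ler_norm (- ecoord a i); rewrite normrN; have := normr_ge0 l; lra.
have := ler_norm (ecoord a i); have := ler_norm l; lra.
Qed.

End cubes.

(** * Comparing a mean with a modular *)

Section variable_exponent.
Variable R : realType.

Lemma gt0_powRE (a x : R) : 0 < a -> a `^ x = expR (x * ln a).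
Proof. by move=> a0; rewrite /powR gt_eqF. Qed.

(** If u > t then u = u^s * u^(1-s) <= u^s * t^(1-s). With a threshold t adapted
    to Q, this compares the integral of f over Q with the modular of f, the
    integral of f^r. *)
Lemma le_threshold_powR (u t s : R) : 0 <= u -> 0 < t -> 1 <= s ->
  u <= t + u `^ s * t `^ (1 - s).
Proof.
move=> u0 t0 s1; have [ut|tu] := leP u t.
  by rewrite (le_trans ut)// lerDl mulr_ge0 ?powR_ge0.
have {}u0 : 0 < u by exact: lt_trans tu.
rewrite -[leLHS]add0r lerD ?(ltW t0)// !gt0_powRE// -expRD -[leLHS]lnK ?posrE// ler_expR.
have : ln t <= ln u by rewrite ler_ln ?posrE// ltW.
nra.
Qed.

Variables (V q D : R).
Hypotheses (V0 : 0 < V) (q1 : 1 <= q).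
Let q0 : 0 < q. Proof. exact: lt_le_trans q1. Qed.

(** V^(s/q) and V agree up to the factor exp D: this is how closeness of s to q,
    at the scale of a set of measure V, is exploited. *)
Let exponent_shift (s : R) : `|ln V| * `|s - q| <= D ->
  `|ln V * (s / q) - ln V| <= D.
Proof.
move=> h; rewrite -{2}[ln V]mulr1 -mulrBr normrM.
apply: le_trans h; rewrite ler_wpM2l//.
rewrite (_ : s / q - 1 = (s - q) / q); last by rewrite mulrBl divff// gt_eqF.
by rewrite normrM normfV (gtr0_norm q0) ler_piMr// invf_le1.
Qed.

Lemma threshold_powR_le (s : R) : `|ln V| * `|s - q| <= D ->
  (V `^ (- q^-1)) `^ (1 - s) <= expR D * (V * V `^ (- q^-1)).
Proof.
move=> /exponent_shift h; rewrite -powRrM !gt0_powRE// -{2}[V]lnK ?posrE//.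
rewrite -!expRD ler_expR.
by move: h; rewrite ler_norml => /andP[_]; lra.
Qed.

Lemma inv_powR_le (K s : R) : 1 <= K -> 1 <= s -> `|ln V| * `|s - q| <= D ->
  ((K * V `^ q^-1)^-1) `^ s <= expR D / K / V.
Proof.
move=> K1 s1 /exponent_shift h; have K0 : 0 < K by exact: lt_le_trans K1.
have L0 : 0 < K * V `^ q^-1 by rewrite mulr_gt0 ?powR_gt0.
rewrite gt0_powRE ?invr_gt0// lnV ?posrE// lnM ?posrE ?powR_gt0// ln_powR.
rewrite -{2}[K]lnK ?posrE// -{2}[V]lnK ?posrE// -!expRN -!expRD ler_expR.
have lK : 0 <= ln K by rewrite ln_ge0.
move: h; rewrite ler_norml => /andP[h _]; nra.
Qed.

End variable_exponent.

Section modular.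
Local Open Scope ereal_scope.
Context d (T : measurableType d) (R : realType).
Variable mu : {measure set T -> \bar R}.

Lemma measurable_fun_powR (Q : set T) (f r : T -> R) :
  measurable Q -> measurable_fun Q f -> measurable_fun Q r ->
  measurable_fun Q (fun x => (f x `^ r x)%R).
Proof.
move=> mQ mf mr; rewrite /powR; apply: measurable_fun_if => //.
- by apply: measurable_fun_eqr => //; exact: measurable_cst.
- apply: (measurable_funS mQ (@subIsetl _ _ _)).
  rewrite (_ : (fun t => _) = (fun t => if r t == 0%R then 1%R else 0%R :> R)); last first.
    by apply/funext => t; case: eqP.
  apply: measurable_fun_if => //; [|exact: measurable_cst..].
  by apply: measurable_fun_eqr => //; exact: measurable_cst.
- apply: (measurable_funS mQ (@subIsetl _ _ _)).
  apply: measurableT_comp => //; apply: measurable_funM => //.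
  by apply: measurableT_comp => //; exact: measurable_ln.
Qed.

(** Q has measure V, and r is so close to the constant q that V^(r/q) and V are
    comparable, except on a set B that is small compared with Q. The bounds on
    the measure of B make its contribution harmless in the modular of a constant
    function ([muB1]) and in the integral of a function of modular at most 1
    ([muB2]). *)
Variables (Q B : set T) (r : T -> R) (V q D A : R).
Hypotheses (mQ : measurable Q) (mB : measurable B) (BQ : B `<=` Q).
Hypotheses (V0 : (0 < V)%R) (muQ : mu Q = V%:E) (q1 : (1 <= q)%R).
Hypotheses (D0 : (0 <= D)%R) (A0 : (0 <= A)%R).
Hypotheses (mr : measurable_fun Q r) (r1 : forall x, Q x -> (1 <= r x)%R).
Hypothesis offB : forall x, Q x -> ~ B x -> (`|ln V| * `|r x - q| <= D)%R.
Hypothesis onB : forall x, B x -> (1 <= V)%R.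
Hypothesis muB1 : mu B <= (A * V `^ q^-1)%:E.
Hypothesis muB2 : mu B <= (A * (V * V `^ (- q^-1)))%:E.

Let K := (expR D + A)%R.
Let eD1 : (1 <= expR D)%R. Proof. by rewrite -(expR0 R) ler_expR. Qed.
Let K1 : (1 <= K)%R. Proof. by rewrite (le_trans eD1)// lerDl. Qed.
Let K0 : (0 < K)%R. Proof. exact: lt_le_trans K1. Qed.
Let q0 : (0 < q)%R. Proof. exact: lt_le_trans q1. Qed.
Let T0 : (0 < V `^ (- q^-1))%R. Proof. exact: powR_gt0. Qed.

Let m1B (c : R) : measurable_fun Q (fun x => (c * \1_B x)%:E).
Proof.
by apply/measurable_EFinP; apply: measurable_funM => //; exact: measurable_cst.
Qed.

Let int1B (c : R) : (0 <= c)%R -> \int[mu]_(x in Q) (c * \1_B x)%:E = c%:E * mu B.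
Proof.
move=> c0; under eq_integral do rewrite EFinM.
rewrite ge0_integralZl//; [|by apply/measurable_EFinP..].
by rewrite integral_indic// (setIidl BQ).
Qed.

(** The norm of the indicator of Q is therefore at most K * V^(1/q). Off B the
    integrand is at most (exp D / K) / V; on B one only uses that the base is
    at most 1 and the exponent at least 1. *)
Lemma modular_cst_le1 :
  \int[mu]_(x in Q) (((K * V `^ q^-1)^-1) `^ r x)%:E <= 1.
Proof.
have L0 : (0 < K * V `^ q^-1)%R by rewrite mulr_gt0 ?powR_gt0.
have L0' : (0 <= (K * V `^ q^-1)^-1)%R by rewrite invr_ge0 ltW.
have E0 : (0 <= expR D / K / V)%R.
  by rewrite divr_ge0 ?(ltW V0)// divr_ge0 ?expR_ge0 ?(ltW K0).
apply: (@le_trans _ _ (\int[mu]_(x in Q)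
    ((expR D / K / V)%:E + ((K * V `^ q^-1)^-1 * \1_B x)%:E))).
  apply: ae_le_integral; apply: aeW => x Qx; rewrite -EFinD lee_fin indicE.
  have [xB|xB] := boolP (x \in B); last first.
    rewrite mulr0 addr0; apply: inv_powR_le => //; first exact: r1.
    by apply: offB => //; move: xB; rewrite notin_setE.
  rewrite mulr1 ler_wpDl// gt0_powRE ?invr_gt0//.
  rewrite -{2}[(_^-1)%R]lnK ?posrE ?invr_gt0// ler_expR.
  rewrite lnV ?posrE// mulrN lerN2 ler_peMl ?r1// ln_ge0//.
  move: xB; rewrite inE => /onB V1; rewrite -[leLHS]mulr1 ler_pM//.
  by rewrite gt0_powRE// -expR0 ler_expR mulr_ge0 ?ln_ge0// invr_ge0 ltW.
rewrite ge0_integralD//; last first.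
  by move=> x _; rewrite lee_fin mulr_ge0.
rewrite integral_cst// int1B// muQ -EFinM.
apply: (@le_trans _ _ ((expR D / K)%:E + (A / K)%:E)); last first.
  by rewrite -EFinD lee_fin -mulrDl divff// gt_eqF.
apply: leeD; first by rewrite lee_fin divfK// gt_eqF.
apply: le_trans (lee_wpmul2l _ muB1) _; first by rewrite lee_fin.
rewrite -EFinM lee_fin; have W0 : (V `^ q^-1 != 0)%R by rewrite gt_eqF ?powR_gt0.
rewrite le_eqVlt; apply/orP; left; apply/eqP; field.
by rewrite W0 gt_eqF.
Qed.

(** [le_threshold_powR] is applied with the threshold V^(-1/q) off B, and with
    the threshold 1 on B, where r may be far from q. *)
Lemma integral_le_modular (f : T -> R) : measurable_fun Q f ->
  (forall x, Q x -> (0 <= f x)%R) ->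
  \int[mu]_(x in Q) (f x `^ r x)%:E <= 1 ->
  \int[mu]_(x in Q) (f x)%:E <= ((2 + K) * (V * V `^ (- q^-1)))%:E.
Proof.
move=> mf f0 fr1; set t := (V `^ (- q^-1))%R.
have Vt0 : (0 <= V * t)%R by rewrite mulr_ge0 ?powR_ge0// ltW.
have k0 : (0 <= (expR D + 1) * (V * t))%R by rewrite mulr_ge0// addr_ge0// expR_ge0.
have mfr : measurable_fun Q (fun x => (f x `^ r x)%:E).
  by apply/measurable_EFinP; exact: measurable_fun_powR.
apply: (@le_trans _ _ (\int[mu]_(x in Q)
    ((t%:E + ((expR D + 1) * (V * t))%:E * (f x `^ r x)%:E) + (1 * \1_B x)%:E))).
  apply: ae_le_integral; apply: aeW => x Qx.
  rewrite -EFinM -!EFinD lee_fin mul1r indicE.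
  have fr0 : (0 <= f x `^ r x)%R by exact: powR_ge0.
  have [xB|xB] := boolP (x \in B).
    have := le_threshold_powR (f0 x Qx) (@ltr01 R) (r1 Qx).
    rewrite powR1 mulr1 => h; apply: (le_trans h).
    have V1 : (1 <= V)%R by move: xB; rewrite inE; exact: onB.
    have Vt1 : (1 <= V * t)%R.
      rewrite /t gt0_powRE// -{1}[V]lnK ?posrE// -expRD -(expR0 R) ler_expR.
      have := ln_ge0 V1; have : (q^-1 <= 1)%R by rewrite invf_le1.
      nra.
    have c1 : (1 <= (expR D + 1) * (V * t))%R.
      by rewrite -[leLHS]mulr1 ler_pM// lerDr expR_ge0.
    rewrite [leLHS]addrC; apply: lerD => //.
    rewrite -[leLHS]add0r; apply: lerD; rewrite ?powR_ge0//.
    by rewrite -[leLHS]mul1r ler_wpM2r.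
  rewrite addr0; apply: le_trans (le_threshold_powR (f0 x Qx) T0 (r1 Qx)) _.
  rewrite lerD2l mulrC ler_wpM2r//.
  apply: le_trans (threshold_powR_le V0 q1 _) _.
    by apply: offB => //; move: xB; rewrite notin_setE.
  by rewrite ler_wpM2r// lerDl.
rewrite ge0_integralD//; last 2 first.
- move=> x _; rewrite -EFinM -EFinD lee_fin addr_ge0 ?powR_ge0//.
  by rewrite mulr_ge0 ?powR_ge0.
- by apply: emeasurable_funD => //; apply: emeasurable_funM.
rewrite ge0_integralD//; last 3 first.
- by move=> x _; rewrite lee_fin powR_ge0.
- by move=> x _; rewrite -EFinM lee_fin mulr_ge0 ?powR_ge0.
- by apply: emeasurable_funM.
rewrite integral_cst// int1B// muQ ge0_integralZl//; last first.
  by move=> x _; rewrite lee_fin powR_ge0.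
apply: (@le_trans _ _ ((t * V)%:E + ((expR D + 1) * (V * t))%:E * 1
    + 1 * (A * (V * t))%:E)).
  rewrite EFinM; apply: leeD; last by rewrite lee_wpmul2l.
  by apply: leeD => //; rewrite lee_wpmul2l// lee_fin.
rewrite mule1 mul1e -!EFinD lee_fin /K; lra.
Qed.

End modular.

(** * Variable Lebesgue norms *)

Section varLnorm_theory.
Variables (R : realType) (n : nat).
Local Notation mu := (lebesgue R n).
Local Open Scope ereal_scope.
Implicit Types (q : euclid R n -> \bar R) (f g : euclid R n -> R).

Lemma le_epow (s t : R) (q : \bar R) : (0 <= s)%R -> (s <= t)%R -> 1 <= q ->
  epow s q <= epow t q.
Proof.
move=> s0 st; case: q => [r||] //=.
  rewrite !lee_fin => r1; apply: ge0_ler_powR; rewrite ?nnegrE//.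
  - exact: le_trans r1.
  - exact: le_trans st.
move=> _; case: ifP => // s1; case: ifP => // t1.
by move: s1; rewrite (le_trans st t1).
Qed.

Lemma varLnorm_ge0 q f : 0 <= varLnorm q f.
Proof. by apply: le_ereal_inf_tmp => _ [l [/ltW l0 _] <-]; rewrite lee_fin. Qed.

(** Monotonicity and homogeneity at once, as they are combined after the
    submultiplicativity of the operator norm. *)
Lemma varLnorm_le_scale q f g (k : R) : (forall x, 1 <= q x) -> (0 < k)%R ->
  (forall x, (`|f x| <= k * `|g x|)%R) -> varLnorm q f <= k%:E * varLnorm q g.
Proof.
move=> q1 k0 fg; rewrite muleC -lee_pdivrMr//.
apply: le_ereal_inf_tmp => _ [l [l0 gl] <-].
rewrite lee_pdivrMr//; apply: ereal_inf_lbound; exists (l * k)%R => //.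
split; first by rewrite mulr_gt0.
apply: le_trans gl; apply: ae_le_integral; apply: aeW => x _.
apply: le_epow => //; rewrite !normrM !normfV (gtr0_norm (mulr_gt0 l0 k0)).
rewrite (gtr0_norm l0) ler_pdivrMr ?mulr_gt0// mulrA divfK ?gt_eqF// mulrC.
exact: fg.
Qed.

Lemma integral_epow_indic q (Q : set (euclid R n)) f (l : R) :
  (forall x, 1 <= q x) ->
  \int[mu]_x epow `|f x * \1_Q x / l|%R (q x) =
  \int[mu]_(x in Q) epow `|f x / l|%R (q x).
Proof.
move=> q1; rewrite [RHS]integral_mkcond; apply: eq_integral => x _.
rewrite patchE indicE; case: ifPn => xQ; first by rewrite mulr1.
rewrite mulr0 mul0r normr0; case: (q x) (q1 x) => [r||] //=.
  by rewrite lee_fin => r1; rewrite powR0// gt_eqF// (lt_le_trans _ r1).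
by rewrite ler01.
Qed.

Lemma varLnorm1E (Q : set (euclid R n)) f : measurable Q -> measurable_fun Q f ->
  varLnorm (fun=> 1) (fun x => f x * \1_Q x)%R = \int[mu]_(x in Q) `|f x|%:E.
Proof.
move=> mQ mf; set I := RHS.
have I0 : 0 <= I by apply: integral_ge0 => x _; rewrite lee_fin.
have mod (l : R) : (0 < l)%R ->
    \int[mu]_x epow `|f x * \1_Q x / l|%R 1 = (l^-1)%:E * I.
  move=> l0; rewrite (@integral_epow_indic (fun=> 1))//.
  have mnf : measurable_fun Q (fun x => `|f x|%:E).
    by apply/measurable_EFinP; exact: measurableT_comp.
  have nf0 x : Q x -> 0 <= `|f x|%:E by rewrite lee_fin.
  have li0 : 0 <= (l^-1)%:E by rewrite lee_fin invr_ge0 ltW.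
  rewrite -(ge0_integralZl mu mQ mnf nf0 li0).
  apply: eq_integral => x _ /=; rewrite powRr1// -EFinM normrM normfV.
  by rewrite (gtr0_norm l0) mulrC.
apply/eqP; rewrite eq_le; apply/andP; split.
  clearbody I; case: I I0 mod => [i|_ _|//]; last by rewrite leey.
  rewrite lee_fin => i0 mod; apply/lee_addgt0Pr => e e0.
  apply: ereal_inf_lbound; exists (i + e)%R => //; split.
    by rewrite ltr_wpDl.
  rewrite mod ?ltr_wpDl// -EFinM lee_fin mulrC ler_pdivrMr ?ltr_wpDl//.
  by rewrite mul1r lerDl ltW.
apply: le_ereal_inf_tmp => _ [l [l0 +] <-]; rewrite mod//.
by rewrite muleC lee_pdivrMr// mul1e.
Qed.

Lemma normalized_varLnorm1E (Q : set (euclid R n)) f : measurable Q ->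
  measurable_fun Q f -> normalized_varLnorm (fun=> 1) Q f =
  average Q (fun x => `|f x|%:E).
Proof.
move=> mQ mf; rewrite /normalized_varLnorm /average varLnorm1E//; congr (_^-1 * _).
have := @varLnorm1E Q (cst 1%R) mQ (measurable_cst _).
rewrite (_ : (fun x => _) = \1_Q); last by apply/funext => x /=; rewrite mul1r.
by move=> ->; under eq_integral do rewrite normr1; rewrite integral_cst// mul1e.
Qed.

End varLnorm_theory.

(** * Means are bounded by variable norms under log-Hoelder continuity *)

Section log_hoelder_exponent.
Variables (R : realType) (n : nat).
Local Notation mu := (lebesgue R n).

Lemma le_inve (x y : \bar R) : (0 <= x)%E -> (x <= y)%E -> (y^-1 <= x^-1)%E.
Proof.
case: x => [x||//]; last by move=> _; rewrite leye_eq => /eqP ->.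
move=> x0; case: y => [y|_|]; [|by rewrite invey inve_ge0|by rewrite leeNy_eq].
rewrite lee_fin in x0; rewrite lee_fin => xy; rewrite !inver; have [_|xn0] := eqVneq x 0.
  by rewrite leey.
have {}x0 : 0 < x by rewrite lt_neqAle eq_sym xn0.
have y0 : 0 < y by exact: lt_le_trans xy.
by rewrite gt_eqF// lee_fin lef_pV2.
Qed.

(** Means are compared with norms by homogeneity: the hypothesis on functions of
    modular at most 1 is applied to f / l for every l that is admissible in the
    definition of the norm of f. The powers of V cancel against the bound
    K * V^(1/q) for the norm of the indicator of Q. *)
Lemma average_le_normalized_varLnorm (Q : set (euclid R n)) (r : euclid R n -> R)
    (V K q : R) (f : euclid R n -> R) :
  measurable Q -> mu Q = V%:E -> 0 < V -> 0 < K ->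
  (forall x, 1 <= r x) ->
  (\int[mu]_(x in Q) (((K * V `^ q^-1)^-1) `^ r x)%:E <= 1)%E ->
  (forall g : euclid R n -> R, measurable_fun Q g -> (forall x, Q x -> 0 <= g x) ->
    (\int[mu]_(x in Q) (g x `^ r x)%:E <= 1)%E ->
    (\int[mu]_(x in Q) (g x)%:E <= ((2 + K) * (V * V `^ (- q^-1)))%:E)%E) ->
  measurable_fun Q f ->
  (average Q (fun x => `|f x|%R%:E) <=
   (K * (2 + K))%:E * normalized_varLnorm (EFin \o r) Q f)%E.
Proof.
move=> mQ muQ V0 K0 r1 cst1 int1 mf.
set lam := K * V `^ q^-1 in cst1.
have lam0 : 0 < lam by rewrite mulr_gt0 ?powR_gt0.
have r1' x : (1 <= (EFin \o r) x)%E by rewrite lee_fin.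
have vQ : (varLnorm (EFin \o r) \1_Q <= lam%:E)%E.
  apply: ereal_inf_lbound; exists lam; last by [].
  split; first exact: lam0.
  apply: le_trans cst1.
  have := integral_epow_indic Q (cst 1) lam r1'.
  under eq_integral do rewrite mul1r.
  move=> ->; apply: ae_le_integral; apply: aeW => x _ /=.
  by rewrite mul1r gtr0_norm ?invr_gt0.
have c0 : 0 < (2 + K) * V `^ (- q^-1) by rewrite mulr_gt0 ?powR_gt0 ?addr_gt0.
set vf := varLnorm (EFin \o r) (fun x => f x * \1_Q x).
apply: (@le_trans _ _ (((2 + K) * V `^ (- q^-1))%:E * vf)%E).
  rewrite muleC -lee_pdivrMr//; apply: le_ereal_inf_tmp => _ [l [l0 fl] <-].
  rewrite lee_pdivrMr// /average muQ inver gt_eqF//.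
  rewrite lee_pdivrMl//.
  have : (\int[mu]_(x in Q) (`|f x| / l)%:E <= ((2 + K) * (V * V `^ (- q^-1)))%:E)%E.
    apply: int1.
    - by apply: measurable_funM; [exact: measurableT_comp|exact: measurable_cst].
    - by move=> x _; rewrite divr_ge0// ltW.
    apply: le_trans fl; rewrite (integral_epow_indic _ _ _ r1').
    apply: ae_le_integral; apply: aeW => x _ /=.
    by rewrite normrM normfV (gtr0_norm l0).
  under eq_integral do rewrite EFinM.
  have mnf : measurable_fun Q (fun x => `|f x|%R%:E).
    by apply/measurable_EFinP; exact: measurableT_comp.
  have nf0 x : Q x -> (0 <= `|f x|%R%:E)%E by rewrite lee_fin.
  have li0 : (0 <= (l^-1)%:E)%E by rewrite lee_fin invr_ge0 ltW.
  rewrite (ge0_integralZr mu mQ mnf nf0 li0).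
  rewrite lee_pdivrMr// -!EFinM => h; apply: le_trans h _.
  by rewrite lee_fin le_eqVlt; apply/orP; left; apply/eqP; ring.
rewrite /normalized_varLnorm muleA lee_wpmul2r ?varLnorm_ge0//.
apply: (@le_trans _ _ ((K * (2 + K))%:E * lam%:E^-1)%E); last first.
  apply: lee_wpmul2l; first by rewrite lee_fin mulr_ge0 ?addr_ge0 ?(ltW K0).
  by apply: le_inve => //; exact: varLnorm_ge0.
rewrite inver gt_eqF// -EFinM lee_fin /lam powRN.
have W0 : V `^ q^-1 != 0 by rewrite gt_eqF ?powR_gt0.
rewrite le_eqVlt; apply/orP; left; apply/eqP; field.
by rewrite W0 gt_eqF.
Qed.

Lemma edist_le_sum (x y : euclid R n) :
  Defs.edist x y <= \sum_i `|ecoord x i - ecoord y i|.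
Proof.
rewrite /Defs.edist; under eq_bigr do rewrite -real_normK ?num_real//.
exact: sqrt_sum_le_sum.
Qed.

Lemma edist_cube_corner a l b c (x : euclid R n) : 0 < l ->
  cube a l b c x -> Defs.edist x a <= n%:R * l.
Proof.
move=> l0 xQ; apply: le_trans (edist_le_sum _ _) _.
apply: le_trans (_ : \sum_(i < n) l <= _); last first.
  by rewrite sumr_const card_ord mulr_natl.
apply: ler_sum => i _; have /andP[h1 h2] := cube_coord xQ i.
by rewrite ger0_norm ?subr_ge0// lerBlDl.
Qed.

Definition diagonal_point (s : R) : euclid R n := [tuple s | _ < n].

Lemma ecoord_diagonal_point s i : ecoord (diagonal_point s) i = s.
Proof. by rewrite /ecoord tnth_mktuple. Qed.

Lemma ln_expR1D (t : R) : 0 <= t -> 1 <= ln (expR 1 + t).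
Proof.
move=> t0; rewrite -[leLHS]expRK ler_ln ?posrE ?expR_gt0// ?lerDl//.
by rewrite ltr_wpDr// expR_gt0.
Qed.

(** The exponent is at least some b > 1 almost everywhere, in particular somewhere
    in a unit cube far from the origin, where it is close to its limit. *)
Lemma limit_exponent_gt1 (r : euclid R n -> R) (roo Coo : R) : (0 < n)%N ->
  0 < Coo ->
  (forall x, `|r x - roo| <= Coo / ln (expR 1 + enorm x)) ->
  (1 < ess_inf mu (EFin \o r))%E -> 1 < roo.
Proof.
move=> n0 Coo0 rroo; rewrite /ess_inf => /ereal_sup_gt[y /= yr y1].
have [b b1 br] : exists2 b : R, 1 < b & {ae mu, forall x, b <= r x}.
  case: y yr y1 => [b||//] yr y1; first by exists b => //; move: yr; apply: filterS.
  exists 2; first by rewrite ltr1n.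
  by apply: filterS yr => x; rewrite /= leye_eq.
rewrite ltNge; apply/negP => roo1.
(* beyond norm s, r is within b - 1 of roo *)
pose s := expR (Coo / (b - 1)).
pose Q := cube (diagonal_point s) 1 (fun=> true) (fun=> true).
have [x Qx bx] : exists2 x, Q x & b <= r x.
  apply: contrapT => noQ; case: br => N [mN muN bN].
  have : (mu Q <= mu N)%E.
    apply: le_measure; rewrite ?inE//; first exact: measurable_cube.
    by move=> x Qx; apply: bN => /= bx; apply: noQ; exists x.
  by rewrite muN lebesgue_cube// expr1n leNgt lte_fin ltr01.
have sx : s <= enorm x.
  apply: le_trans (ecoord_le_enorm x (Ordinal n0)).
  apply: le_trans (ler_norm _).
  by have /andP[+ _] := cube_coord Qx (Ordinal n0); rewrite ecoord_diagonal_point.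
have b10 : 0 < b - 1 by rewrite subr_gt0.
have lnx : Coo / (b - 1) < ln (expR 1 + enorm x).
  rewrite -[ltLHS]expRK ltr_ln ?posrE ?expR_gt0//; last first.
    by rewrite addr_gt0 ?expR_gt0// (lt_le_trans _ sx) ?expR_gt0.
  by rewrite (le_lt_trans sx)// ltrDr expR_gt0.
have lnx0 : 0 < ln (expR 1 + enorm x) by rewrite (lt_trans _ lnx)// divr_gt0.
have := rroo x; rewrite ler_pdivlMr//; move: lnx; rewrite ltr_pdivrMr// => lnx h.
have := ler_norm (r x - roo); nra.
Qed.

(** The hypotheses of [modular_cst_le1] and [integral_le_modular], with D and A
    singled out: only they have to be independent of the cube. *)
Definition nearly_constant (r : euclid R n -> R) (D A : R) (Q : set (euclid R n))
    (V : R) : Prop :=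
  exists (q : R) (B : set (euclid R n)), [/\ 1 <= q, measurable B, B `<=` Q,
    (forall x, Q x -> ~ B x -> `|ln V| * `|r x - q| <= D) /\
    (forall x, B x -> 1 <= V) &
    (mu B <= (A * V `^ q^-1)%:E)%E /\ (mu B <= (A * (V * V `^ (- q^-1)))%:E)%E].

Lemma nearly_constant_everywhere r D A Q V q : 0 <= A -> 0 < V -> 1 <= q ->
  (forall x, Q x -> `|ln V| * `|r x - q| <= D) -> nearly_constant r D A Q V.
Proof.
move=> A0 V0 q1 h; exists q, set0; split => //; first by split => // x /h.
by rewrite measure0; split; rewrite lee_fin !mulr_ge0 ?powR_ge0// ltW.
Qed.

Lemma abs_ln_expn (l : R) : 0 < l -> `|ln (l ^+ n)| = n%:R * `|ln l|.
Proof. by move=> l0; rewrite lnXn// -[ln l *+ n]mulr_natl normrM normr_nat. Qed.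

(** Local log-Hoelder continuity: for points of a cube of edge l, the distance e
    to the corner a is at most n * l <= sqrt l / 2, so that, unless e = 0, |ln e| is
    at least half of |ln l|, while |ln V| = n * |ln l|. *)
Lemma nearly_constant_small_cube r C0 A a l b c : (0 < n)%N -> 0 < C0 -> 0 <= A ->
  (forall x, 1 <= r x) ->
  (forall x y, Defs.edist x y < 2^-1 -> `|r x - r y| <= - (C0 / ln (Defs.edist x y))) ->
  0 < l -> l * (4 * n%:R ^+ 2) <= 1 ->
  nearly_constant r (2 * n%:R * C0) A (cube a l b c) (l ^+ n).
Proof.
move=> n0 C00 A0 r1 rLH l0 ln4.
apply: (@nearly_constant_everywhere _ _ _ _ _ (r a)) => //; first exact: exprn_gt0.
move=> x xQ; set e := Defs.edist x a.
have e0 : 0 <= e by exact: sqrtr_ge0.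
have en : e <= n%:R * l by exact: edist_cube_corner xQ.
have N1 : 1 <= n%:R :> R by rewrite ler1n.
have l4 : l <= 4^-1 by rewrite -[4^-1]mul1r ler_pdivlMr//; nra.
have e2 : e ^+ 2 * 4 <= l.
  have : e ^+ 2 <= (n%:R * l) ^+ 2 by rewrite ler_sqr ?nnegrE// mulr_ge0// ltW.
  nra.
have ehalf : e < 2^-1 by nra.
have ll0 : ln l < 0 by apply: ln_lt0; rewrite l0/=; lra.
have := rLH x a ehalf; rewrite -/e => h.
rewrite abs_ln_expn// (ltr0_norm ll0).
move: e0; rewrite le_eqVlt => /predU1P[e0|e0].
  move: h; rewrite -e0 ln0// invr0 mulr0 oppr0 normr_le0 => /eqP ->.
  by rewrite normr0 mulr0 !mulr_ge0// ltW.
have le2 : ln e *+ 2 <= ln l.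
  by rewrite -lnXn// ler_ln ?posrE ?exprn_gt0//; have := sqr_ge0 e; lra.
have le0 : ln e < 0 by lra.
have {}h : `|r x - r a| * - ln e <= C0.
  move: h; rewrite -mulrN -invrN -ler_pdivrMr ?invr_gt0 ?oppr_gt0//.
  by rewrite invrK.
have := normr_ge0 (r x - r a).
rewrite -mulrA (mulrC 2) -!mulrA ler_wpM2l//; nra.
Qed.

(** For edges between (4 n^2)^-1 and 1 the number |ln V| is bounded, and so is the
    distance of r to its limit. *)
Lemma nearly_constant_medium_cube r roo Coo A a l b c : (0 < n)%N ->
  0 < Coo -> 0 <= A -> 1 <= roo ->
  (forall x, `|r x - roo| <= Coo / ln (expR 1 + enorm x)) ->
  0 < l -> l <= 1 -> 1 <= l * (4 * n%:R ^+ 2) ->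
  nearly_constant r (n%:R * (ln (4 * n%:R ^+ 2) * Coo)) A (cube a l b c) (l ^+ n).
Proof.
move=> n0 Coo0 A0 roo1 rLH l0 l1 l4.
apply: (@nearly_constant_everywhere _ _ _ _ _ roo) => //; first exact: exprn_gt0.
move=> x xQ; rewrite abs_ln_expn// -mulrA ler_wpM2l//.
have N0 : 0 < 4 * n%:R ^+ 2 :> R by rewrite mulr_gt0// exprn_gt0// ltr0n.
apply: ler_pM => //.
  rewrite ler0_norm ?ln_le0// -lnV ?posrE// ler_ln ?posrE ?invr_gt0//.
  by rewrite -[leLHS]mul1r ler_pdivrMr// mulrC.
apply: le_trans (rLH x) _; rewrite ler_pdivrMr.
  by rewrite ler_peMr ?(ltW Coo0)// ln_expR1D// sqrtr_ge0.
by rewrite (lt_le_trans ltr01)// ln_expR1D// sqrtr_ge0.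
Qed.

(** Decay at infinity: r is compared with its limit roo. At a point of norm
    more than l^d, the logarithm in the decay condition is at least d * ln l, which
    compensates |ln V| = n * ln l. The exceptional set is the part of the cube in
    the box of half-edge l^d, of measure at most 2^n * V^d; the choice of d makes
    this at most 2^n * V^(1/roo) and 2^n * V^(1-1/roo). That d is positive is the
    assumption roo > 1. *)
Lemma nearly_constant_large_cube r roo Coo a l b c : (0 < n)%N ->
  0 < Coo -> 1 < roo ->
  (forall x, `|r x - roo| <= Coo / ln (expR 1 + enorm x)) -> 1 < l ->
  nearly_constant r (n%:R * (Coo / Num.min roo^-1 (1 - roo^-1))) (2 ^+ n)
    (cube a l b c) (l ^+ n).
Proof.
move=> n0 Coo0 roo1 rLH l1; set d := Num.min _ _.
have l0 : 0 < l by rewrite (lt_trans ltr01).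
have roo0 : 0 < roo by rewrite (lt_trans ltr01).
have d0 : 0 < d by rewrite lt_min invr_gt0 roo0 subr_gt0 invf_lt1.
have V1 : 1 <= l ^+ n by rewrite exprn_ege1// ltW.
have V0 : 0 < l ^+ n by rewrite exprn_gt0.
pose s := l `^ d.
have s0 : 0 < s by exact: powR_gt0.
pose S := cube (diagonal_point (- s)) (2 * s) (fun=> true) (fun=> false).
have muS : (mu S = (2 ^+ n * (l ^+ n) `^ d)%:E)%E.
  rewrite lebesgue_cube ?mulr_gt0// exprMn; congr (_ * _)%:E.
  by rewrite /s -(powR_mulrn n (powR_ge0 l d)) powRAC (powR_mulrn n (ltW l0)).
have muB : (mu (cube a l b c `&` S) <= (2 ^+ n * (l ^+ n) `^ d)%:E)%E.
  rewrite -muS; apply: le_measure; rewrite ?inE//; last exact: measurable_cube.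
  by apply: measurableI; exact: measurable_cube.
exists roo, (cube a l b c `&` S); split => //.
- exact: ltW.
- by apply: measurableI; exact: measurable_cube.
- split => // x Qx xB.
  have sx : s < enorm x.
    rewrite ltNge; apply/negP => xs; apply: xB; split => // i.
    have := le_trans (ecoord_le_enorm x i) xs; rewrite ler_norml => /andP[h1 h2].
    rewrite in_itv /= ecoord_diagonal_point h1 /=; apply: le_trans h2 _; lra.
  have lns : ln s = d * ln l by rewrite ln_powR.
  have ll0 : 0 < ln l by rewrite ln_gt0.
  have lnx : d * ln l <= ln (expR 1 + enorm x).
    rewrite -lns ler_ln ?posrE//; last first.
      by rewrite addr_gt0 ?expR_gt0// (lt_trans s0).
    by rewrite (le_trans (ltW sx))// lerDr expR_ge0.
  rewrite abs_ln_expn// (gtr0_norm ll0) -mulrA ler_wpM2l//.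
  have := rLH x; rewrite ler_pdivlMr; last by rewrite (lt_le_trans _ lnx)// mulr_gt0.
  move=> h; rewrite ler_pdivlMr//; have := normr_ge0 (r x - roo); nra.
- split; apply: le_trans muB _; rewrite lee_fin ler_wpM2l// ?exprn_ge0//.
    by rewrite ler_powR// ge_min lexx.
  rewrite -{2}[l ^+ n]powRr1 ?(ltW V0)// -powRD; last by rewrite (gt_eqF V0) implybT.
  by rewrite ler_powR// ge_min lexx orbT.
Qed.

(** The mean over a cube is controlled by the normalised variable norm, uniformly
    in the cube; this has the content of Hoelder's inequality for variable exponents
    combined with |Q| ~ ||1_Q||_p ||1_Q||_p'. *)
Lemma log_hoelder_average_le (r : euclid R n -> R) : (0 < n)%N ->
  (forall x, 1 <= r x) -> (1 < ess_inf mu (EFin \o r))%E -> log_hoelder r ->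
  exists2 C : R, 0 < C & forall (Q : set (euclid R n)) (f : euclid R n -> R),
    is_cube Q -> measurable_fun Q f ->
    (average Q (fun x => `|f x|%R%:E) <=
     C%:E * normalized_varLnorm (EFin \o r) Q f)%E.
Proof.
move=> n0 r1 rinf [mr [C0 C00 rloc] [roo [Coo [_ Coo0] rfar]]].
have roo1 := limit_exponent_gt1 n0 Coo0 rfar rinf.
have N0 : 1 <= n%:R :> R by rewrite ler1n.
pose D1 := 2 * n%:R * C0.
pose D2 := n%:R * (ln (4 * n%:R ^+ 2) * Coo).
pose D3 := n%:R * (Coo / Num.min roo^-1 (1 - roo^-1)).
pose D := Num.max D1 (Num.max D2 D3).
have D0 : 0 <= D by rewrite le_max !mulr_ge0 ?(ltW C00).
pose A : R := 2 ^+ n.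
have A0 : 0 <= A by exact: exprn_ge0.
have osc a l b c : 0 < l -> nearly_constant r D A (cube a l b c) (l ^+ n).
  move=> l0.
  have mono D' : D' <= D -> nearly_constant r D' A (cube a l b c) (l ^+ n) ->
      nearly_constant r D A (cube a l b c) (l ^+ n).
    move=> DD [q [B [? ? ? [h ?] ?]]]; exists q, B; split => //; split => //.
    by move=> x Qx Bx; exact: le_trans (h x Qx Bx) DD.
  have [l1|l1] := leP (l * (4 * n%:R ^+ 2)) 1.
    apply: (mono D1); first by rewrite le_max lexx.
    exact: nearly_constant_small_cube.
  have [l2|l2] := leP l 1.
    apply: (mono D2); first by rewrite !le_max lexx orbT.
    by apply: (nearly_constant_medium_cube _ _ _ (roo := roo)) => //; exact: ltW.
  apply: (mono D3); first by rewrite !le_max lexx !orbT.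
  exact: (nearly_constant_large_cube _ _ _ (roo := roo)).
pose K := expR D + A.
have K0 : 0 < K by rewrite ltr_wpDr// expR_gt0.
exists (K * (2 + K)); first by rewrite mulr_gt0// addr_gt0.
move=> Q f [a [l [b [c [l0 ->]]]]] mf.
have [q [B [q1 mB BQ [offB onB] [muB1 muB2]]]] := osc a l b c l0.
have mQ := measurable_cube a l b c.
have muQ := lebesgue_cube a b c l0.
have mrQ : measurable_fun (cube a l b c) r by exact: measurable_funTS.
have V0 : 0 < l ^+ n by exact: exprn_gt0.
apply: (@average_le_normalized_varLnorm _ r (l ^+ n) K q) => //.
- exact: (@modular_cst_le1 _ _ _ mu _ B r (l ^+ n) q D A).
- by move=> g mg g0 gr; apply: (@integral_le_modular _ _ _ mu _ B r (l ^+ n) q D A).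
Qed.

End log_hoelder_exponent.

(** * Averages of a matrix weight over a cube *)

Lemma le_norm_mul_indic (R : realType) (a b k i : R) : 0 <= a -> 0 <= b ->
  a <= k * b -> `|a * i| <= k * `|b * i|.
Proof.
move=> a0 b0 akb; rewrite !normrM (ger0_norm a0) (ger0_norm b0).
by have := ler_wpM2r (normr_ge0 i) akb; rewrite -mulrA.
Qed.

Section weights_on_a_cube.
Variables (R : realType) (n m : nat) (W : euclid R n -> 'M[R[i]]_m).
Hypotheses (m0 : (0 < m)%N) (wW : matrix_weight W).
Local Notation mu := (lebesgue R n).
Variables (Q : set (euclid R n)) (V : R).
Hypotheses (mQ : measurable Q) (V0 : 0 < V) (muQ : mu Q = V%:E).
Hypothesis bQ : exists r, forall x, Q x -> enorm x <= r.

Lemma averageE (f : euclid R n -> \bar R) :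
  average Q f = ((V^-1)%:E * \int[mu]_(x in Q) f x)%E.
Proof. by rewrite /average muQ inver gt_eqF. Qed.

Lemma le_average (f g : euclid R n -> \bar R) :
  {ae mu, forall x, Q x -> (f x <= g x)%E} -> (average Q f <= average Q g)%E.
Proof.
move=> fg; rewrite !averageE lee_wpmul2l ?lee_fin ?invr_ge0 ?(ltW V0)//.
exact: ae_le_integral.
Qed.

Lemma average_lty (f : euclid R n -> \bar R) :
  (average Q f < +oo)%E -> (\int[mu]_(x in Q) f x < +oo)%E.
Proof.
rewrite averageE; case: (\int[mu]_(x in Q) f x)%E => [r||] //.
  by move=> _; rewrite ltry.
by rewrite gt0_muley ?lte_fin ?invr_gt0.
Qed.

Lemma integral_cst_EFin (k : R) : (\int[mu]_(x in Q) k%:E = (k * V)%:E)%E.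
Proof.
transitivity (k%:E * mu Q)%E; last by rewrite muQ.
exact: integral_cst.
Qed.

Lemma integrable_cst (k : R) : mu.-integrable Q (fun=> k%:E).
Proof.
by apply/integrableP; split => //; rewrite integral_cst_EFin ltry.
Qed.

Lemma average_EFinD_cst (phi : euclid R n -> R) (k : R) :
  mu.-integrable Q (EFin \o phi) ->
  (average Q (fun x => (phi x + k)%:E) = average Q (EFin \o phi) + k%:E)%E.
Proof.
move=> iphi; rewrite !averageE; under eq_integral do rewrite EFinD.
have ik := integrable_cst k.
rewrite integralD// integral_cst_EFin muleDr//; last first.
  by rewrite fin_num_adde_defl// -EFinM.
by congr (_ + _)%E; rewrite -EFinM mulrCA mulVf ?mulr1// gt_eqF.
Qed.

Lemma weight_cmeasurable i j : cmeasurable_fun Q (fun x => W x i j).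
Proof.
have [h1 h2] := wW.2 i j Q mQ bQ.
by split; apply/measurable_EFinP; [move: h1|move: h2]; exact: measurable_int.
Qed.

Lemma measurable_opnorm_weight M : measurable_fun Q (fun x => opnorm (W x *m M)).
Proof.
apply: (measurable_opnorm m0); apply: cmeasurable_mulmxr.
exact: weight_cmeasurable.
Qed.

Lemma integrable_opnorm_weight M :
  mu.-integrable Q (fun x => (opnorm (W x *m M))%:E).
Proof.
have il : mu.-integrable Q (fun x => (l1norm (W x))%:E).
  rewrite /l1norm; under eq_fun do rewrite -sumEFin.
  apply: integrable_sum => // i _; under eq_fun do rewrite -sumEFin.
  apply: integrable_sum => // j _; have [h1 h2] := wW.2 i j Q mQ bQ.
  exact: (integrableD mQ (integrable_abse h1) (integrable_abse h2)).
have il' := integrableZr mQ (opnorm M) il.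
apply: (le_integrable mQ _ _ il').
  by apply/measurable_EFinP; exact: measurable_opnorm_weight.
move=> x Qx; rewrite -EFinM !abse_EFin lee_fin.
rewrite !ger0_norm ?mulr_ge0 ?l1norm_ge0 ?opnorm_ge0//.
apply: le_trans (opnormM m0 _ _) _; rewrite ler_wpM2r ?opnorm_ge0//.
exact: le_trans (opnorm_le_entry m0 _) (entry_norm_le_l1norm _).
Qed.

(** The average is finite by local integrability, see [weight_averageE]. *)
Definition weight_average M : R :=
  fine (average Q (fun x => (opnorm (W x *m M))%:E)).

Lemma weight_averageE M :
  average Q (fun x => (opnorm (W x *m M))%:E) = (weight_average M)%:E.
Proof.
rewrite /weight_average fineK// averageE fin_numM//.
exact: integrable_fin_num (integrable_opnorm_weight M).
Qed.

Lemma weight_integralE M :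
  (\int[mu]_(x in Q) (opnorm (W x *m M))%:E = (V * weight_average M)%:E)%E.
Proof.
by rewrite EFinM -weight_averageE averageE muleA -EFinM divff ?gt_eqF// mul1e.
Qed.

Lemma weight_average_ge0 M : 0 <= weight_average M.
Proof.
rewrite -lee_fin -weight_averageE averageE mule_ge0 ?lee_fin ?invr_ge0 ?(ltW V0)//.
by apply: integral_ge0 => x _; rewrite lee_fin opnorm_ge0.
Qed.

Lemma opnorm_weight_gt0 M : M != 0 ->
  {ae mu, forall x, Q x -> 0 < opnorm (W x *m M)}.
Proof.
move=> M0; apply: filterS wW.1 => x [_ Wx] _.
rewrite lt_neqAle opnorm_ge0// andbT eq_sym; apply/eqP => /(opnorm_eq0 m0) h.
by case/eqP: M0; rewrite -[M](mulKmx Wx) h mulmx0.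
Qed.

Lemma weight_average_gt0 M : M != 0 -> 0 < weight_average M.
Proof.
move=> M0; rewrite lt_neqAle weight_average_ge0 andbT eq_sym; apply/eqP => h.
have /ae_eq_integral_abs : measurable_fun Q (fun x => (opnorm (W x *m M))%:E).
  by apply/measurable_EFinP; exact: measurable_opnorm_weight.
move=> /(_ mu mQ)[+ _].
under eq_integral do rewrite abse_EFin ger0_norm ?opnorm_ge0//.
rewrite weight_integralE h mulr0 => /(_ erefl) g0.
have [N [mN muN QN]] : {ae mu, forall x, ~ Q x}.
  have g1 := opnorm_weight_gt0 M0.
  apply: filterS2 g0 g1 => x h1 h2 Qx.
  by have := h2 Qx; have [->] := h1 Qx; rewrite ltxx.
have : (mu Q <= mu N)%E.
  by apply: le_measure; rewrite ?inE// => x Qx; apply: QN => /=; apply.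
by rewrite muN muQ lee_fin leNgt V0.
Qed.

Section exponent_q.
Variable q : euclid R n -> \bar R.
Hypothesis q1 : forall x, (1 <= q x)%E.

Definition weight_norm (y : euclid R n) : \bar R :=
  normalized_varLnorm q Q (fun x => opnorm (W x *m invmx (W y))).

Lemma normalized_varLnorm_ge0 f : (0 <= normalized_varLnorm q Q f)%E.
Proof. by rewrite mule_ge0 ?inve_ge0 ?varLnorm_ge0. Qed.

Lemma weight_norm_ge0 y : (0 <= weight_norm y)%E.
Proof. exact: normalized_varLnorm_ge0. Qed.

(** Submultiplicativity: W(x) M = (W(x) W(y)^-1) (W(y) M). *)
Lemma normalized_weight_le M (y : euclid R n) : W y \in unitmx ->
  0 < opnorm (W y *m M) ->
  (normalized_varLnorm q Q (fun x => opnorm (W x *m M)) <=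
   (opnorm (W y *m M))%:E * weight_norm y)%E.
Proof.
move=> Wy g0; rewrite /weight_norm /normalized_varLnorm muleCA.
rewrite lee_wpmul2l ?inve_ge0 ?varLnorm_ge0//.
apply: varLnorm_le_scale => [//|//|x].
apply: le_norm_mul_indic; [exact: opnorm_ge0..|].
have {1}-> : W x *m M = (W x *m invmx (W y)) *m (W y *m M).
  by rewrite -mulmxA (mulKmx Wy).
rewrite [leRHS]mulrC; exact: (opnormM m0).
Qed.

(** The logarithm of [normalized_weight_le], where ln of g = ||W(y) M|| has been
    bounded by its tangent at the mean a of g: ln g <= g / a - 1 + ln a. The result
    is an integrable lower bound of ln (weight_norm y), whose average is explicit. *)
Lemma ln_weight_norm_ge M (c : R) : M != 0 -> 0 < c ->
  (c%:E <= normalized_varLnorm q Q (fun x => opnorm (W x *m M)))%E ->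
  {ae mu, forall y, Q y ->
    ((- (weight_average M)^-1 * opnorm (W y *m M)
      + (1 + ln c - ln (weight_average M)))%:E <= lne (weight_norm y))%E}.
Proof.
move=> M0 c0 cN; have a0 := weight_average_gt0 M0.
apply: filterS2 wW.1 (opnorm_weight_gt0 M0) => y [_ Wy] g0 Qy.
have {}g0 := g0 Qy; set g := opnorm _ in g0 *; set a := weight_average M in a0 *.
have := le_trans cN (normalized_weight_le Wy g0); rewrite -/g.
have : (0 <= weight_norm y)%E by exact: normalized_varLnorm_ge0.
case: (weight_norm y) => [N|_ _|//]; last by rewrite leey.
rewrite lee_fin -EFinM lee_fin => N0 cgN.
have {}N0 : 0 < N.
  rewrite lt_neqAle N0 andbT; apply/eqP => N00.
  by move: cgN; rewrite -N00 mulr0 leNgt c0.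
rewrite lne_EFin// lee_fin.
have : ln c <= ln g + ln N by rewrite -lnM ?posrE// ler_ln ?posrE ?mulr_gt0.
have ga0 : 0 < g / a by rewrite divr_gt0.
have : ln (g / a) <= g / a - 1.
  rewrite -{1}[g / a](addrNK 1) [_ + 1]addrC; apply: le_ln1Dx.
  by rewrite ltrBrDr addNr.
rewrite ln_div ?posrE// mulNr [a^-1 * g]mulrC; lra.
Qed.

Lemma integrable_ln_lower_bound M (k : R) :
  mu.-integrable Q (fun y => (- (weight_average M)^-1 * opnorm (W y *m M) + k)%:E).
Proof.
have ik := integrable_cst k.
under eq_fun do rewrite EFinD EFinM.
by apply: integrableD => //; apply: integrableZl => //; exact: integrable_opnorm_weight.
Qed.

Lemma average_ln_lower_bound M (k : R) : M != 0 ->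
  average Q (fun y => (- (weight_average M)^-1 * opnorm (W y *m M) + k)%:E) =
  (k - 1)%:E.
Proof.
move=> M0; have a0 := weight_average_gt0 M0.
rewrite (average_EFinD_cst (phi := fun y => - (weight_average M)^-1 * opnorm (W y *m M))).
  rewrite averageE /=; under eq_integral do rewrite EFinM.
  rewrite integralZl//; last exact: integrable_opnorm_weight.
  rewrite weight_integralE -!EFinM -EFinD; congr EFin.
  by field; rewrite !gt_eqF.
have := integrable_ln_lower_bound M 0; congr (_.-integrable _ _).
by apply/funext => y /=; rewrite addr0.
Qed.

(** The reverse Hoelder inequality on one cube. Averaging [ln_weight_norm_ge] over
    y is Jensen's inequality for the logarithm of ||W(y) M||. *)
Lemma normalized_weight_le_exp_average M :
  (normalized_varLnorm q Q (fun x => opnorm (W x *m M)) <=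
   expeR (average Q (fun y => lne (weight_norm y))) *
   average Q (fun x => (opnorm (W x *m M))%:E))%E.
Proof.
rewrite weight_averageE; set E := expeR _; set N := normalized_varLnorm _ _ _.
have rhs0 : (0 <= E * (weight_average M)%:E)%E.
  by rewrite mule_ge0 ?expeR_ge0// lee_fin weight_average_ge0.
(* for M = 0 the mean of ||W M|| vanishes, so there is no tangent to take *)
have [M0|M0] := eqVneq M 0.
  suff -> : N = 0%E by [].
  rewrite /N /normalized_varLnorm [X in (_ * X)%E](_ : _ = 0%E) ?mule0//.
  apply/eqP; rewrite eq_le varLnorm_ge0 andbT.
  apply/lee_addgt0Pr => e e0; rewrite add0e.
  apply: ereal_inf_lbound; exists e => //; split => //.
  rewrite (eq_integral (cst 0%E)) ?integral0 ?lee01// => x _ /=.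
  rewrite M0 mulmx0 opnorm0// !mul0r normr0; case: (q x) (q1 x) => [s||] //=.
    by rewrite lee_fin => s1; rewrite powR0// gt_eqF// (lt_le_trans _ s1).
  by rewrite ler01.
have a0 := weight_average_gt0 M0.
(* N is approached by finite c, since it may be +oo *)
have key c : 0 < c -> (c%:E <= N)%E -> (c%:E <= E * (weight_average M)%:E)%E.
  move=> c0 cN; have := le_average (ln_weight_norm_ge M0 c0 cN).
  rewrite average_ln_lower_bound// -lee_expeR /= => h.
  rewrite -lee_pdivrMr//; apply: le_trans h; rewrite -EFinM lee_fin.
  rewrite (_ : 1 + ln c - _ - 1 = ln c - ln (weight_average M)); last by ring.
  by rewrite expRB !lnK ?posrE.
move: key; have : (0 <= N)%E by exact: normalized_varLnorm_ge0.
case: N => [c||//].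
  rewrite lee_fin le_eqVlt => /predU1P[<- _ //|c0] key.
  exact: key.
move=> _ key; rewrite leye_eq; apply/eqP/eqyP => c c0.
by apply: key; rewrite ?leey.
Qed.

End exponent_q.

Lemma normalized_varLnorm1_weight M :
  normalized_varLnorm (fun=> 1%E) Q (fun x => opnorm (W x *m M)) =
  (weight_average M)%:E.
Proof.
rewrite (normalized_varLnorm1E mQ (measurable_opnorm_weight M)) -weight_averageE.
by congr average; apply/funext => x; rewrite (ger0_norm (opnorm_ge0 m0 _)).
Qed.

Lemma weight_norm1E (y : euclid R n) :
  weight_norm (fun=> 1%E) y = (weight_average (invmx (W y)))%:E.
Proof. exact: normalized_varLnorm1_weight. Qed.

Let scale_cancel (a b c k : R) : V * a <= V * b + V * c * k -> a <= b + c * k.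
Proof. by rewrite -mulrA -mulrDr ler_pM2l. Qed.

(** Used with [measurable_lipschitz_matrix]: it makes the mean over x of
    ||W(x) W(y)^-1|| a measurable function of y. *)
Lemma weight_average_lipschitz A B :
  weight_average A <= weight_average B + weight_average 1%:M * l1norm (A - B).
Proof.
have iB := integrable_opnorm_weight B; have i1 := integrable_opnorm_weight 1%:M.
move: (weight_integralE A) (weight_integralE B) (weight_integralE 1%:M).
move: (weight_average A) (weight_average B) (weight_average 1%:M) => a b c.
move: (l1norm _) (entry_norm_le_l1norm (A - B)) => k hk eA eB e1.
apply: scale_cancel; rewrite -lee_fin EFinD (EFinM _ k) -eA -eB -e1.
rewrite -(integralZr mQ i1) -(integralD mQ iB (integrableZr mQ k i1)).
apply: ae_le_integral; apply: aeW => x _; rewrite /= -EFinM -EFinD lee_fin mulmx1.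
apply: (le_trans (opnorm_le_dist m0 _ (W x *m B))); rewrite lerD2l -mulmxBr.
apply: (le_trans (opnormM m0 _ _)); apply: ler_wpM2l; first exact: opnorm_ge0.
exact: le_trans (opnorm_le_entry m0 _) hk.
Qed.

(** For invertible W(y), the logarithm of the weight norm of exponent 1 at y, with
    the inverse written by cofactors, so as to be measurable in y. *)
Definition log_weight_average (y : euclid R n) : R :=
  ln (weight_average ((\det (W y))^-1 *: \adj (W y))).

Lemma measurable_log_weight_average : measurable_fun Q log_weight_average.
Proof.
apply: (@measurableT_comp _ _ _ _ _ _ (@ln R) Q
  (fun y => weight_average ((\det (W y))^-1 *: \adj (W y)))).
  exact: measurable_ln.
apply: (measurable_lipschitz_matrix (weight_average_ge0 1%:M)).
  exact: weight_average_lipschitz.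
move=> i j; apply: (@eq_cmeasurable _ _ _ _
    (fun y => (\det (W y))^-1 * \adj (W y) i j)) => [y|]; first by rewrite !mxE.
apply: cmeasurableM; last by apply: cmeasurable_adj; exact: weight_cmeasurable.
by apply/cmeasurableV/cmeasurable_det; exact: weight_cmeasurable.
Qed.

Lemma ae_lne_weight_norm1 : {ae mu, forall y, Q y ->
  lne (weight_norm (fun=> 1%E) y) = (log_weight_average y)%:E}.
Proof.
apply: filterS wW.1 => y [_ Wy] _.
rewrite weight_norm1E /log_weight_average.
have -> : (\det (W y))^-1 *: \adj (W y) = invmx (W y) by rewrite /invmx Wy.
rewrite lne_EFin// weight_average_gt0//; apply/eqP => W0.
have := mulmxV Wy; rewrite W0 mulmx0 => /matrixP/(_ (Ordinal m0) (Ordinal m0)).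
by rewrite !mxE eqxx => /eqP; rewrite eq_sym oner_eq0.
Qed.

(** An integrable lower bound is provided by [ln_weight_norm_ge] with exponent 1
    and M = 1; so it suffices that some upper bound has an average below +oo. *)
Lemma integrable_log_weight_average (u : euclid R n -> \bar R) (k : R) :
  {ae mu, forall y, Q y -> ((log_weight_average y + k)%:E <= u y)%E} ->
  (average Q u < +oo)%E ->
  mu.-integrable Q (EFin \o log_weight_average).
Proof.
move=> lu /average_lty ult.
have I0 : (1%:M : 'M[R[i]]_m) != 0.
  apply/eqP => /matrixP/(_ (Ordinal m0) (Ordinal m0)).
  by rewrite !mxE eqxx => /eqP; rewrite oner_eq0.
have a0 := weight_average_gt0 I0.
have lb := ln_weight_norm_ge (q := fun=> 1%E) (fun=> lexx _) I0 a0 _.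
have ilk : mu.-integrable Q (fun y => (log_weight_average y + k)%:E).
  apply: (integrable_between mQ _ (integrable_ln_lower_bound 1%:M (1 + k)) _ lu ult).
    apply/measurable_EFinP; apply: measurable_funD => //.
    exact: measurable_log_weight_average.
  apply: filterS2 (lb _) ae_lne_weight_norm1 => [y h1 h2 Qy|].
    have := h1 Qy; rewrite h2// addrK lee_fin => h.
    by rewrite lee_fin addrA lerD2r.
  by rewrite normalized_varLnorm1_weight.
have := integrableB mQ ilk (integrable_cst k); congr (_.-integrable _ _).
by apply/funext => y /=; rewrite -EFinB addrK.
Qed.

Lemma exp_average_lnD (phi : euclid R n -> R) (k : R) : 0 < k ->
  mu.-integrable Q (EFin \o phi) ->
  (expeR (average Q (fun x => (phi x + ln k)%:E)) =
   expeR (average Q (EFin \o phi)) * k%:E)%E.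
Proof.
move=> k0 iphi; rewrite average_EFinD_cst// expeRD; congr (_ * _)%E.
by rewrite /= lnK.
Qed.

Lemma lne_le_scale (C : R) (x y : \bar R) : 0 < C -> (0 <= x)%E -> (0 <= y)%E ->
  (x <= C%:E * y)%E -> (lne x <= lne y + (ln C)%:E)%E.
Proof.
move=> C0 x0 y0; case: y y0 => [y y0|_ _|//]; last by rewrite addye// leey.
case: x x0 => [x x0||//]; last by rewrite -EFinM leye_eq.
rewrite -EFinM lee_fin => xCy.
have [x00|xp] := leP x 0; first by rewrite le0_lneNy ?lee_fin// leNye.
have yp : 0 < y by rewrite -(pmulr_rgt0 _ C0) (lt_le_trans xp).
rewrite !lne_EFin// -EFinD lee_fin addrC -lnM ?posrE// ler_ln ?posrE//.
exact: mulr_gt0.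
Qed.

(** Only one of ln u and ln v is known to be integrable, the other function being
    arbitrary; here it is ln u, and in the next lemma ln v. The constant is moved
    to the side of the integrable function, where averages are additive. *)
Lemma exp_average_le_scale_l (u v : euclid R n -> \bar R) (phi : euclid R n -> R)
    (C : R) : 0 < C -> (forall y, 0 <= u y)%E -> (forall y, 0 <= v y)%E ->
  (forall y, u y <= C%:E * v y)%E ->
  mu.-integrable Q (EFin \o phi) ->
  {ae mu, forall y, Q y -> lne (u y) = (phi y)%:E} ->
  (expeR (average Q (fun y => lne (u y))) <=
   expeR (average Q (fun y => lne (v y))) * C%:E)%E.
Proof.
move=> C0 u0 v0 uv iphi uphi.
have : (average Q (fun y => (phi y + ln C^-1)%:E) <= average Q (fun y => lne (v y)))%E.
  apply: le_average; apply: filterS uphi => y h Qy.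
  have := lne_le_scale C0 (u0 y) (v0 y) (uv y).
  by rewrite (h Qy) lnV ?posrE// EFinB leeBlDr.
rewrite -lee_expeR exp_average_lnD ?invr_gt0// lee_pdivrMr//.
apply: le_trans; rewrite lee_expeR; apply: le_average.
by apply: filterS uphi => y h Qy; rewrite (h Qy).
Qed.

Lemma exp_average_le_scale_r (u v : euclid R n -> \bar R) (phi : euclid R n -> R)
    (C : R) : 0 < C -> (forall y, 0 <= u y)%E -> (forall y, 0 <= v y)%E ->
  (forall y, u y <= C%:E * v y)%E ->
  mu.-integrable Q (EFin \o phi) ->
  {ae mu, forall y, Q y -> lne (v y) = (phi y)%:E} ->
  (expeR (average Q (fun y => lne (u y))) <=
   expeR (average Q (fun y => lne (v y))) * C%:E)%E.
Proof.
move=> C0 u0 v0 uv iphi vphi.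
apply: (@le_trans _ _ (expeR (average Q (fun y => (phi y + ln C)%:E)))).
  rewrite lee_expeR; apply: le_average; apply: filterS vphi => y h Qy.
  by rewrite EFinD -(h Qy); exact: lne_le_scale.
rewrite exp_average_lnD// lee_wpmul2r ?lee_fin ?(ltW C0)// lee_expeR.
by apply: le_average; apply: filterS vphi => y h Qy; rewrite (h Qy).
Qed.

Lemma exp_average_weight_norm1_le (q : euclid R n -> \bar R) (C : R) : 0 < C ->
  (forall y, weight_norm (fun=> 1%E) y <= C%:E * weight_norm q y)%E ->
  (average Q (fun y => lne (weight_norm q y)) < +oo)%E ->
  (expeR (average Q (fun y => lne (weight_norm (fun=> 1%E) y))) <=
   expeR (average Q (fun y => lne (weight_norm q y))) * C%:E)%E.
Proof.
move=> C0 le1q qlt.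
have n0 := weight_norm_ge0.
apply: (exp_average_le_scale_l C0 (n0 _) (n0 _) le1q _ ae_lne_weight_norm1).
apply: (@integrable_log_weight_average _ (ln C^-1)) qlt.
move: (weight_norm q) (weight_norm (fun=> 1%E)) (n0 q) (n0 (fun=> 1%E))
  ae_lne_weight_norm1 le1q => v u v0 u0 uphi uv.
apply: filterS uphi => y h Qy; have := lne_le_scale C0 (u0 y) (v0 y) (uv y).
by rewrite (h Qy) lnV ?posrE// EFinB leeBlDr.
Qed.

Lemma exp_average_weight_norm_le1 (q : euclid R n -> \bar R) (K : R) : 0 < K ->
  (forall y, weight_norm q y <= K%:E * weight_norm (fun=> 1%E) y)%E ->
  (average Q (fun y => lne (weight_norm (fun=> 1%E) y)) < +oo)%E ->
  (expeR (average Q (fun y => lne (weight_norm q y))) <=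
   expeR (average Q (fun y => lne (weight_norm (fun=> 1%E) y))) * K%:E)%E.
Proof.
move=> K0 leq1 lt1.
have n0 := weight_norm_ge0.
apply: (exp_average_le_scale_r K0 (n0 _) (n0 _) leq1 _ ae_lne_weight_norm1).
apply: (@integrable_log_weight_average _ 0) lt1.
move: (weight_norm (fun=> 1%E)) ae_lne_weight_norm1 => u uphi.
by apply: filterS uphi => y h Qy; rewrite (h Qy) addr0.
Qed.

End weights_on_a_cube.

(** * The characterisation of the weight class *)

Lemma cube_volume (R : realType) (n : nat) (Q : set (euclid R n)) : is_cube Q ->
  exists2 V : R, 0 < V & [/\ measurable Q, lebesgue R n Q = V%:E &
    exists r, forall x, Q x -> enorm x <= r].
Proof.
move=> [a [l [b [c [l0 ->]]]]]; exists (l ^+ n); first exact: exprn_gt0.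
split; [exact: measurable_cube|exact: lebesgue_cube|exact: bounded_cube].
Qed.

Theorem proposition3p19 (R : realType) (m n : nat) (m_gt0 : (0 < m)%N)
    (n_gt0 : (0 < n)%N) (p : euclid R n -> \bar R) (p_exp : exponent p)
    (p_gt1 : (1 < ess_inf (lebesgue R n) p)%E) (p_LH : LH p) :
  exists2 C : R, 0 < C &
  forall W : euclid R n -> 'M[R[i]]_m, matrix_weight W ->
    (A_infty p W <->
       A_infty (fun=> 1%E) W /\
       exists2 K : R, 0 < K & reverse_hoelder p W K%:E) /\
    (A_infty p W -> reverse_hoelder p W (C%:E * A_infty_const p W)%E).
Proof.
have [r pr r_LH] := p_LH; have {}pr : p = EFin \o r by apply/funext.
subst p; have [_ p1] := p_exp.
have r1 x : 1 <= r x by rewrite -lee_fin; exact: p1.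
have [C C0 avgC] := log_hoelder_average_le n_gt0 r1 p_gt1 r_LH.
(* the reverse Hoelder inequality holds with constant 1 *)
exists 1; first exact: ltr01.
move=> W wW.
have const_ge q Q : is_cube Q ->
    (expeR (average Q (fun y => lne (weight_norm W Q q y))) <= A_infty_const q W)%E.
  by move=> cQ; apply: ereal_sup_ubound; exists Q.
have avg_lty q Q : is_cube Q -> (A_infty_const q W < +oo)%E ->
    (average Q (fun y => lne (weight_norm W Q q y)) < +oo)%E.
  move=> cQ /(le_lt_trans (const_ge q Q cQ)).
  by rewrite !ltey expeR_eqy.
have RH : reverse_hoelder (EFin \o r) W (1%:E * A_infty_const (EFin \o r) W)%E.
  move=> M Q cQ; have [V V0 [mQ muQ bQ]] := cube_volume cQ.
  apply: (le_trans (normalized_weight_le_exp_average m_gt0 wW mQ V0 muQ bQ p1 M)).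
  rewrite mul1e; apply: lee_wpmul2r; last exact: const_ge.
  rewrite (weight_averageE m_gt0 wW mQ V0 muQ bQ) lee_fin.
  exact: (weight_average_ge0 m_gt0 wW mQ V0 muQ bQ).
split; last by move=> _; exact: RH.
split.
  move=> [_ Alt]; split; last first.
    (* the maximum with 1 only serves to have K > 0 *)
    pose K := Num.max 1 (fine (A_infty_const (EFin \o r) W)).
    exists K; first by rewrite lt_max ltr01.
    move=> M Q cQ; apply: (le_trans (RH M Q cQ)).
    have [V V0 [mQ muQ bQ]] := cube_volume cQ.
    rewrite mul1e; apply: lee_wpmul2r.
      rewrite (weight_averageE m_gt0 wW mQ V0 muQ bQ) lee_fin.
      exact: (weight_average_ge0 m_gt0 wW mQ V0 muQ bQ).
    have : (0 <= A_infty_const (EFin \o r) W)%E.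
      exact: le_trans (expeR_ge0 _) (const_ge _ _ cQ).
    rewrite /K; case: (A_infty_const _ _) Alt => [k||//] // _ _.
    by rewrite lee_fin le_max lexx orbT.
  split; first exact: wW.
  apply: (@le_lt_trans _ _ (A_infty_const (EFin \o r) W * C%:E)%E); last first.
    by rewrite muleC; apply: lte_mul_pinfty; [rewrite lee_fin ltW| |exact: Alt].
  apply: ge_ereal_sup => _ [Q cQ <-]; have [V V0 [mQ muQ bQ]] := cube_volume cQ.
  have mW y := measurable_opnorm_weight m_gt0 wW mQ bQ (invmx (W y)).
  have N1p y : (weight_norm W Q (fun=> 1) y <= C%:E * weight_norm W Q (EFin \o r) y)%E.
    by rewrite /weight_norm (normalized_varLnorm1E mQ (mW y)); exact: avgC.
  apply: (le_trans (exp_average_weight_norm1_le m_gt0 wW mQ V0 muQ bQ C0 N1p _)).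
    exact: avg_lty.
  by apply: lee_wpmul2r; [rewrite lee_fin ltW|exact: const_ge].
move=> [[_ Alt] [K K0 RHK]]; split; first exact: wW.
apply: (@le_lt_trans _ _ (A_infty_const (fun=> 1%E) W * K%:E)%E); last first.
  by rewrite muleC; apply: lte_mul_pinfty; [rewrite lee_fin ltW| |exact: Alt].
apply: ge_ereal_sup => _ [Q cQ <-]; have [V V0 [mQ muQ bQ]] := cube_volume cQ.
have Np1 y : (weight_norm W Q (EFin \o r) y <= K%:E * weight_norm W Q (fun=> 1) y)%E.
  rewrite (weight_norm1E m_gt0 wW mQ V0 muQ bQ).
  by rewrite -(weight_averageE m_gt0 wW mQ V0 muQ bQ); exact: RHK.
apply: (le_trans (exp_average_weight_norm_le1 m_gt0 wW mQ V0 muQ bQ K0 Np1 _)).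
  exact: avg_lty.
by apply: lee_wpmul2r; [rewrite lee_fin ltW|exact: const_ge].
Qed.
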